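(* Let $\alpha$ be an ordinal and let $M$ and $N$ be two transitive models of $\mathsf{ZF}$ which have the same $\alpha$-sets (i.e. a set is an $\alpha$-set in $M$ if and only if it is an $\alpha$-set in $N$, and these coincide). If $M\models\mathsf{KWP}_\alpha$, then $M=N$.
   Context: The $\alpha$-sets of ordinals are defined by recursion on $\alpha$: $0$-sets are sets of ordinals; $(\alpha+1)$-sets are sets of $\alpha$-sets; for limit $\alpha$, an $\alpha$-set is a union $\bigcup\mathcal A$ where every $A\in\mathcal A$ is a $\beta$-set for some $\beta<\alpha$ (equivalently, a subset of $\mathcal P^\alpha(\eta)$ for some ordinal $\eta$). $\mathsf{KWP}_\alpha$ is the statement that every set is equipotent with an $\alpha$-set. *)

(* Defs.v *)
Set Implicit Arguments.
Unset Strict Implicit.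

(** The background universe: any extensional, well-founded membership
    structure.  Closure properties are demanded only of the models inside it. *)
Record set_universe := {
  carrier :> Type;
  mem : carrier -> carrier -> Prop;
  mem_ext : forall x y : carrier, (forall z, mem z x <-> mem z y) -> x = y;
  mem_wf : well_founded mem
}.

Arguments mem {_} _ _.

Declare Scope zf_scope.
Notation "x ∈ y" := (mem x y) (at level 70, no associativity) : zf_scope.
Local Open Scope zf_scope.

(** First-order formulas of the language {∈, =}, with de Bruijn indices; [f_bot]
    and [f_imp] generate the remaining connectives classically. *)
Inductive form : Type :=
| f_mem : nat -> nat -> form
| f_eq : nat -> nat -> form
| f_bot : form
| f_imp : form -> form -> form
| f_all : form -> form.

Definition scons {A : Type} (x : A) (e : nat -> A) (n : nat) : A :=
  match n with 0 => x | S m => e m end.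

Section Models.
Variable V : set_universe.

(** A class may be proper or coextensive with an element of the universe; no
    definability is required. *)
Definition class := V -> Prop.

Implicit Types (M N : class) (e : nat -> V).

(** [sat M e phi] is (M, ∈) ⊨ phi under the assignment [e]. *)
Fixpoint sat M e (phi : form) : Prop :=
  match phi with
  | f_mem i j => e i ∈ e j
  | f_eq i j => e i = e j
  | f_bot => False
  | f_imp p q => sat M e p -> sat M e q
  | f_all p => forall x, M x -> sat M (scons x e) p
  end.

Definition transitive_class M := forall x y, M x -> y ∈ x -> M y.

(** The axioms of ZF relativized to [M].  In the two schemes [phi] ranges over
    first-order formulas and [e] supplies parameters from [M]. *)
Record models_ZF M : Prop := {
  zf_extensionality : forall x y, M x -> M y ->
    (forall z, M z -> (z ∈ x <-> z ∈ y)) -> x = y;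
  zf_foundation : forall x, M x -> (exists y, M y /\ y ∈ x) ->
    exists y, M y /\ y ∈ x /\ forall z, M z -> ~ (z ∈ x /\ z ∈ y);
  zf_pairing : forall x y, M x -> M y ->
    exists p, M p /\ forall z, M z -> (z ∈ p <-> z = x \/ z = y);
  zf_union : forall x, M x ->
    exists u, M u /\ forall z, M z -> (z ∈ u <-> exists y, M y /\ y ∈ x /\ z ∈ y);
  zf_power : forall x, M x ->
    exists p, M p /\ forall y, M y ->
      (y ∈ p <-> forall z, M z -> z ∈ y -> z ∈ x);
  zf_infinity : exists w, M w /\
    (exists z, M z /\ z ∈ w /\ forall y, M y -> ~ y ∈ z) /\
    (forall x, M x -> x ∈ w ->
       exists y, M y /\ y ∈ w /\ forall z, M z -> (z ∈ y <-> z ∈ x \/ z = x));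
  zf_separation : forall (phi : form) e, (forall n, M (e n)) ->
    forall a, M a ->
    exists b, M b /\
      forall x, M x -> (x ∈ b <-> x ∈ a /\ sat M (scons x e) phi);
  zf_replacement : forall (phi : form) e, (forall n, M (e n)) ->
    forall a, M a ->
    (forall x, M x -> x ∈ a -> forall y y', M y -> M y' ->
       sat M (scons y (scons x e)) phi ->
       sat M (scons y' (scons x e)) phi -> y = y') ->
    exists b, M b /\
      forall y, M y ->
        (y ∈ b <-> exists x, M x /\ x ∈ a /\ sat M (scons y (scons x e)) phi)
}.

(** The notions from here to [is_bijection] have all their quantifiers bounded
    by their arguments (or are equivalent to such in a transitive model of ZF),
    so they are not relativized. *)

Definition transitive_set (x : V) := forall y z, y ∈ x -> z ∈ y -> z ∈ x.

(** A transitive set linearly ordered by ∈; irreflexivity, transitivity and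
    well-foundedness of the order come from [mem_wf]. *)
Definition is_ordinal (x : V) :=
  transitive_set x /\ forall y z, y ∈ x -> z ∈ x -> y ∈ z \/ y = z \/ z ∈ y.

Definition is_empty (x : V) := forall y, ~ y ∈ x.

Definition is_succ (b a : V) := forall y, y ∈ a <-> y ∈ b \/ y = b.

Definition is_limit (a : V) :=
  is_ordinal a /\ ~ is_empty a /\ ~ exists b, is_succ b a.

Definition is_union (x A : V) := forall y, y ∈ x <-> exists B, B ∈ A /\ y ∈ B.

Definition is_upair (p x y : V) := forall z, z ∈ p <-> z = x \/ z = y.

(** Kuratowski pairs. *)
Definition is_pair (p x y : V) :=
  forall z, z ∈ p <-> is_upair z x x \/ is_upair z x y.

Definition is_bijection (f x y : V) :=
  (forall p, p ∈ f -> exists a b, a ∈ x /\ b ∈ y /\ is_pair p a b) /\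
  (forall a, a ∈ x -> exists! b, b ∈ y /\ exists p, p ∈ f /\ is_pair p a b) /\
  (forall b, b ∈ y -> exists! a, a ∈ x /\ exists p, p ∈ f /\ is_pair p a b).

(** For [M x], [alpha_set_in M a x] says that [x] is an [a]-set in the sense of
    [M].  The recursion on [a] may be carried out outside [M] because membership
    is well-founded; the only unbounded quantifier in it, the family [A] of the
    limit step, ranges over [M].  The index [a] need not belong to [M]. *)
Inductive alpha_set_in M : V -> V -> Prop :=
| alpha_set_zero a x :
    is_empty a ->
    (forall y, y ∈ x -> is_ordinal y) ->
    alpha_set_in M a x
| alpha_set_succ a b x :
    is_succ b a ->
    (forall y, y ∈ x -> alpha_set_in M b y) ->
    alpha_set_in M a x
| alpha_set_limit a x A :
    is_limit a ->
    M A -> is_union x A ->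
    (forall B, B ∈ A -> exists b, b ∈ a /\ alpha_set_in M b B) ->
    alpha_set_in M a x.

Definition same_alpha_sets (a : V) M N :=
  forall x, (M x /\ alpha_set_in M a x) <-> (N x /\ alpha_set_in N a x).

(** M ⊨ KWP_a. *)
Definition models_KWP (a : V) M :=
  forall x, M x ->
    exists A, M A /\ alpha_set_in M a A /\ exists f, M f /\ is_bijection f x A.

End Models.

(* Main.v *)
(** The idea is to code the membership relation of a set of [M] by an alpha-set.
    In [M], a transitive set [t] is equipotent with an alpha-set [A].  Pairs of
    elements of [A] can be coded, in the same way in [M] and in [N], by sets of the
    level of the elements of [A], so that the relation on [A] that corresponds to
    membership on [t] becomes an alpha-set.  It belongs to [N], and its Mostowski
    collapse in [N] gives back [t]; hence [M] is contained in [N].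

    Coding pairs: when [alpha = 0], pairs of ordinals are counted in lexicographic
    order; when [alpha = 1], sets [X], [Y] of ordinals are coded by a disjoint union
    of ordinals; when [alpha >= 2], elements [X], [Y] of [A] are coded by
    [X ∪ {z ∪ {k} | z ∈ Y}] for an ordinal [k] that belongs to no element of [X]
    and [Y].

    Conversely let [x] be a set of [N] whose elements lie in [M].  The rank of [x] in
    [N] is an ordinal, thus in [M], so [x] is a subset of some [y] in [M].  A
    bijection of [M] from [y] to an alpha-set maps [x] to an alpha-set of [N],
    which is in [M]; pulling it back gives [x]. *)

From Stdlib Require Import Classical.
Require Import Defs.
Local Open Scope zf_scope.

(** * Definability with parameters *)

Fixpoint rename (r : nat -> nat) (phi : form) : form :=
  match phi with
  | f_mem i j => f_mem (r i) (r j)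
  | f_eq i j => f_eq (r i) (r j)
  | f_bot => f_bot
  | f_imp p q => f_imp (rename r p) (rename r q)
  | f_all p => f_all (rename (fun n => match n with 0 => 0 | S m => S (r m) end) p)
  end.

(** Places [f] on the even and [g] on the odd indices, so that one environment can serve two
    formulas with disjoint free variables. *)
Fixpoint interleave {A : Type} (f g : nat -> A) (n : nat) : A :=
  match n with 0 => f 0 | S m => interleave g (fun k => f (S k)) m end.

Fixpoint double (n : nat) : nat := match n with 0 => 0 | S m => S (S (double m)) end.

Lemma interleave_double {A : Type} n :
  forall f g : nat -> A,
    interleave f g (double n) = f n /\ interleave f g (S (double n)) = g n.
Proof.
induction n as [|n IH]; intros f g; [easy|].
destruct (IH (fun k => f (S k)) (fun k => g (S k))) as [H1 H2].
split; [exact H1 | exact H2].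
Qed.

Lemma sat_ext {V : set_universe} (M : class V) phi :
  forall e e', (forall n, e n = e' n) -> (sat M e phi <-> sat M e' phi).
Proof.
induction phi as [i j|i j| |p IHp q IHq|p IHp]; intros e e' H; cbn.
- now rewrite !H.
- now rewrite !H.
- tauto.
- rewrite (IHp e e' H), (IHq e e' H); tauto.
- split; intros Hs x Hx; specialize (Hs x Hx); revert Hs; apply IHp;
    intros [|n]; cbn; auto.
Qed.

Lemma sat_rename {V : set_universe} (M : class V) phi :
  forall r e, sat M e (rename r phi) <-> sat M (fun n => e (r n)) phi.
Proof.
induction phi as [i j|i j| |p IHp q IHq|p IHp]; intros r e; cbn; try tauto.
- rewrite IHp, IHq; tauto.
- split; intros Hs x Hx; specialize (Hs x Hx); revert Hs; rewrite IHp;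
    apply sat_ext; intros [|n]; reflexivity.
Qed.

Section Definability.
Context {V : set_universe} (M : class V).

Definition tval (e : nat -> V) (s : nat + V) : V :=
  match s with inl i => e i | inr p => p end.

(** Definability with parameters: [r] sends each free variable of [phi] either
    to a variable of the assignment or to a parameter from [M]. *)
Definition definable (P : (nat -> V) -> Prop) : Prop :=
  exists phi (r : nat -> nat + V), (forall n p, r n = inr p -> M p) /\
    forall e, (forall n, M (e n)) ->
      (sat M (fun n => tval e (r n)) phi <-> P e).

(** The language has no function symbols, so terms are variables or parameters. Giving them as
    functions of the assignment lets goals keep the shape of ordinary propositions. *)
Definition is_term (t : (nat -> V) -> V) : Prop :=
  exists s, (forall p, s = inr p -> M p) /\ forall e, t e = tval e s.

Lemma is_term_var i : is_term (fun e => e i).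
Proof. exists (inl i); split; [discriminate | reflexivity]. Qed.

Lemma is_term_const p : M p -> is_term (fun _ => p).
Proof. intros Hp; exists (inr p); split; [congruence | reflexivity]. Qed.

Lemma definable_equiv P Q :
  (forall e, (forall n, M (e n)) -> (P e <-> Q e)) -> definable P -> definable Q.
Proof.
intros HPQ (phi & r & Hr & H); exists phi, r; split; [exact Hr|].
intros e He; rewrite H, HPQ; tauto.
Qed.

Lemma definable_mem s t :
  is_term s -> is_term t -> definable (fun e => s e ∈ t e).
Proof.
intros (a & Ha & Hs) (b & Hb & Ht).
exists (f_mem 0 1), (fun n => match n with 0 => a | _ => b end); split.
- intros [|n] p Hp; auto.
- intros e He; cbn; rewrite Hs, Ht; tauto.
Qed.

Lemma definable_eq s t :
  is_term s -> is_term t -> definable (fun e => s e = t e).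
Proof.
intros (a & Ha & Hs) (b & Hb & Ht).
exists (f_eq 0 1), (fun n => match n with 0 => a | _ => b end); split.
- intros [|n] p Hp; auto.
- intros e He; cbn; rewrite Hs, Ht; tauto.
Qed.

Lemma definable_false : definable (fun _ => False).
Proof. exists f_bot, (@inl nat V); split; [discriminate | cbn; tauto]. Qed.

(** The two formulas come with unrelated environments; moving their variables to even and odd
    indices makes them compatible. *)
Lemma definable_imp P Q :
  definable P -> definable Q -> definable (fun e => P e -> Q e).
Proof.
intros (phi & r & Hr & H) (psi & s & Hs & H').
exists (f_imp (rename double phi) (rename (fun n => S (double n)) psi)),
  (interleave r s); split.
- assert (Hi : forall n (f g : nat -> nat + V),
    (forall n p, f n = inr p -> M p) -> (forall n p, g n = inr p -> M p) ->
    forall p, interleave f g n = inr p -> M p).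
  { clear; induction n as [|n IH]; intros f g Hf Hg p; cbn; [apply Hf|].
    apply IH; [exact Hg | intros m; apply Hf]. }
  intros n; apply Hi; assumption.
- intros e He; cbn; rewrite !sat_rename, <- (H e He), <- (H' e He).
  rewrite (sat_ext M phi _ (fun n => tval e (r n))),
    (sat_ext M psi _ (fun n => tval e (s n))); [tauto| |];
    intros n; destruct (interleave_double n r s) as [H1 H2]; congruence.
Qed.

(** Several variables of [phi] may stand for [e 0]; all of them are renamed to the bound index 0 and
    the others are shifted. The new environment has a dummy value at the indices that no longer
    occur. *)
Lemma definable_all P :
  definable (fun e => P (fun n => e (S n)) (e 0)) ->
  definable (fun e => forall x, M x -> P e x).
Proof.
intros (phi & r & Hr & H).
exists (f_all (rename (fun n => match r n with inl 0 => 0 | _ => S n end) phi)),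
  (fun n => match r n with inl (S i) => inl i | inl 0 => inl 0 | inr p => inr p end).
split.
- intros n p; specialize (Hr n p); destruct (r n) as [[|i]|q]; auto; discriminate.
- intros e He; cbn.
  enough (Hx : forall x, M x ->
    (sat M (scons x (fun n => tval e
       match r n with inl (S i) => inl i | inl 0 => inl 0 | inr p => inr p end))
       (rename (fun n => match r n with inl 0 => 0 | _ => S n end) phi) <-> P e x)).
  { split; intros Hs x Mx; apply (Hx x Mx), Hs, Mx. }
  intros x Mx; rewrite sat_rename.
  rewrite (sat_ext M phi _ (fun n => tval (scons x e) (r n))).
  + apply (H (scons x e)); intros [|n]; cbn; auto.
  + intros n; destruct (r n) as [[|i]|q] eqn:E; cbn; rewrite ?E; reflexivity.
Qed.

Lemma definable_subst P (s : nat -> nat + V) :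
  (forall n p, s n = inr p -> M p) ->
  definable P -> definable (fun e => P (fun n => tval e (s n))).
Proof.
intros Hs (phi & r & Hr & H).
exists phi, (fun n => match r n with inl i => s i | inr p => inr p end); split.
- intros n p; specialize (Hr n p); destruct (r n) as [i|q]; auto.
  apply Hs.
- intros e He; rewrite <- H.
  + apply sat_ext; intros n; destruct (r n); reflexivity.
  + intros n; specialize (Hs n); destruct (s n); cbn; auto.
Qed.

(** This and the next two lemmas allow a notion shown definable once, on variables, to be used at
    arbitrary terms. *)
Lemma definable1 (R : V -> Prop) s :
  definable (fun e => R (e 0)) -> is_term s -> definable (fun e => R (s e)).
Proof.
intros HR (a & Ha & Hs).
apply definable_equiv with (fun e => R (tval e a)).
- intros e _; rewrite Hs; tauto.
- apply (definable_subst _ (fun _ => a)) in HR; [exact HR | intros _; exact Ha].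
Qed.

Lemma definable2 (R : V -> V -> Prop) s t :
  definable (fun e => R (e 0) (e 1)) ->
  is_term s -> is_term t -> definable (fun e => R (s e) (t e)).
Proof.
intros HR (a & Ha & Hs) (b & Hb & Ht).
apply definable_equiv with (fun e => R (tval e a) (tval e b)).
- intros e _; rewrite Hs, Ht; tauto.
- apply (definable_subst _ (fun n => match n with 0 => a | _ => b end)) in HR;
    [exact HR | intros [|n]; assumption].
Qed.

Lemma definable3 (R : V -> V -> V -> Prop) s t u :
  definable (fun e => R (e 0) (e 1) (e 2)) ->
  is_term s -> is_term t -> is_term u -> definable (fun e => R (s e) (t e) (u e)).
Proof.
intros HR (a & Ha & Hs) (b & Hb & Ht) (c & Hc & Hu).
apply definable_equiv with (fun e => R (tval e a) (tval e b) (tval e c)).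
- intros e _; rewrite Hs, Ht, Hu; tauto.
- apply (definable_subst _ (fun n => match n with 0 => a | 1 => b | _ => c end)) in HR;
    [exact HR | intros [|[|n]]; assumption].
Qed.

Lemma definable_not P : definable P -> definable (fun e => ~ P e).
Proof. intros HP; exact (definable_imp _ _ HP definable_false). Qed.

Lemma definable_and P Q :
  definable P -> definable Q -> definable (fun e => P e /\ Q e).
Proof.
intros HP HQ; apply definable_equiv with (fun e => ~ (P e -> ~ Q e)).
- intros e _; tauto.
- apply definable_not, definable_imp, definable_not; assumption.
Qed.

Lemma definable_or P Q :
  definable P -> definable Q -> definable (fun e => P e \/ Q e).
Proof.
intros HP HQ; apply definable_equiv with (fun e => ~ P e -> Q e).
- intros e _; tauto.
- apply definable_imp; [apply definable_not|]; assumption.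
Qed.

Lemma definable_iff P Q :
  definable P -> definable Q -> definable (fun e => P e <-> Q e).
Proof. intros HP HQ; apply definable_and; apply definable_imp; assumption. Qed.

Lemma definable_ex P :
  definable (fun e => P (fun n => e (S n)) (e 0)) ->
  definable (fun e => exists x, M x /\ P e x).
Proof.
intros HP; apply definable_equiv with (fun e => ~ forall x, M x -> ~ P e x).
- intros e _; split.
  + intros H; apply NNPP; intros H'; apply H; intros x Mx Px; apply H'; eauto.
  + intros (x & Mx & Px) H; exact (H x Mx Px).
- apply definable_not, (definable_all (fun e x => ~ P e x)), definable_not, HP.
Qed.

Hypothesis M_trans : transitive_class M.

Lemma is_term_M t e : is_term t -> (forall n, M (e n)) -> M (t e).
Proof. intros ([i|p] & Hs & Ht) He; rewrite Ht; cbn; auto. Qed.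

(** A quantifier bounded by an element of [M] ranges over [M] anyway, by transitivity. Under the
    binder, a variable in [t] is shifted by one. *)
Lemma definable_ball t P :
  is_term t -> definable (fun e => P (fun n => e (S n)) (e 0)) ->
  definable (fun e => forall x, x ∈ t e -> P e x).
Proof.
intros Ht HP.
apply definable_equiv with (fun e => forall x, M x -> x ∈ t e -> P e x).
- intros e He; split; intros H x; [|auto].
  intros Hx; apply H; [|exact Hx].
  exact (M_trans _ _ (is_term_M t e Ht He) Hx).
- apply (definable_all (fun e x => x ∈ t e -> P e x)), definable_imp; [|exact HP].
  apply (definable_mem (fun e => e 0)); [apply is_term_var|].
  destruct Ht as ([i|p] & Hs & Ht).
  + exists (inl (S i)); split; [discriminate|]. intros e; exact (Ht _).
  + exists (inr p); split; [exact Hs|]. intros e; exact (Ht _).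
Qed.

Lemma definable_bex t P :
  is_term t -> definable (fun e => P (fun n => e (S n)) (e 0)) ->
  definable (fun e => exists x, x ∈ t e /\ P e x).
Proof.
intros Ht HP.
apply definable_equiv with (fun e => ~ forall x, x ∈ t e -> ~ P e x).
- intros e _; split.
  + intros H; apply NNPP; intros H'; apply H; intros x Mx Px; apply H'; eauto.
  + intros (x & Mx & Px) H; exact (H x Mx Px).
- apply definable_not, (definable_ball t (fun e x => ~ P e x) Ht), definable_not, HP.
Qed.

End Definability.

(** Follows the syntax of the property. A relation without a rule of its own is looked up among the
    hypotheses, so proofs first pose the definability of the notions that they use. *)
Ltac definability :=
  repeat (cbv beta;
    first [ assumption
          | simple apply is_term_var
          | simple apply is_term_const
          | simple apply definable_mem
          | simple apply definable_eq
          | simple apply definable_false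
          | simple apply definable_and
          | simple apply definable_or
          | simple apply definable_iff
          | simple apply definable_not
          | simple apply definable_all
          | simple apply definable_ex
          | simple apply definable_ball
          | simple apply definable_bex
          | simple apply definable_imp
          | match goal with |- definable ?M (fun e => ?R (@?s e)) =>
              apply (definable1 M R s); [assumption|] end
          | match goal with |- definable ?M (fun e => ?R (@?s e) (@?t e)) =>
              apply (definable2 M R s t); [assumption| |] end
          | match goal with |- definable ?M (fun e => ?R (@?s e) (@?t e) (@?u e)) =>
              apply (definable3 M R s t u);
                [assumption| | |] end ]).

(** * Sets and recursion in a transitive model *)

Definition pair_in {V : set_universe} (g a u : V) : Prop :=
  exists p, p ∈ g /\ is_pair p a u.

Section Model.
Context {V : set_universe} (M : class V).
Hypothesis M_trans : transitive_class M.
Hypothesis M_ZF : models_ZF M.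

Lemma M_ext x y : M x -> M y -> (forall z, M z -> (z ∈ x <-> z ∈ y)) -> x = y.
Proof. apply (zf_extensionality M_ZF). Qed.

Lemma separation (P : V -> Prop) a :
  definable M (fun e => P (e 0)) -> M a ->
  exists b, M b /\ forall x, x ∈ b <-> x ∈ a /\ P x.
Proof.
intros (phi & r & Hr & H) Ma.
(* [P] looks only at [e 0], so every other variable may take any value in [M]; [a] is a default. *)
set (e := fun n => tval (fun _ => a) (r n)).
assert (Me : forall n, M (e n)).
{ intros n; unfold e; specialize (Hr n); destruct (r n); cbn; auto. }
destruct (zf_separation M_ZF
  (rename (fun n => match r n with inl 0 => 0 | _ => S n end) phi) Me Ma)
  as (b & Mb & Hb).
exists b; split; [exact Mb|].
assert (Hx : forall x, M x -> (x ∈ b <-> x ∈ a /\ P x)).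
{ intros x Mx; rewrite (Hb x Mx), sat_rename, <- (H (scons x (fun _ => a))).
  - rewrite (sat_ext M phi _ (fun n => tval (scons x (fun _ => a)) (r n))); [tauto|].
    intros n; destruct (r n) as [[|i]|q] eqn:E; cbn; unfold e; rewrite ?E; reflexivity.
  - intros [|n]; trivial. }
intros x; split.
- intros Hxb; apply Hx; eauto.
- intros [Hxa Px]; apply Hx; eauto.
Qed.

Lemma replacement (P : V -> V -> Prop) a :
  definable M (fun e => P (e 0) (e 1)) -> M a ->
  (forall x y y', x ∈ a -> M y -> M y' -> P x y -> P x y' -> y = y') ->
  exists b, M b /\ forall y, M y -> (y ∈ b <-> exists x, x ∈ a /\ P x y).
Proof.
intros (phi & r & Hr & H) Ma HP.
(* The axiom scheme has the value at index 0 and the argument at index 1, while [P] takes the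
   argument first; hence the swap. *)
set (psi := rename (fun n => match r n with inl 0 => 1 | inl 1 => 0 | _ => S (S n) end) phi).
set (e := fun n => tval (fun _ => a) (r n)).
assert (Me : forall n, M (e n)).
{ intros n; unfold e; specialize (Hr n); destruct (r n); cbn; auto. }
assert (Hpsi : forall x y, M x -> M y -> (sat M (scons y (scons x e)) psi <-> P x y)).
{ intros x y Mx My; unfold psi; rewrite sat_rename.
  rewrite <- (H (scons x (scons y (fun _ => a)))).
  - apply sat_ext.
    intros n; destruct (r n) as [[|[|i]]|q] eqn:E; cbn; unfold e; rewrite ?E; reflexivity.
  - intros [|[|n]]; trivial. }
destruct (zf_replacement M_ZF (phi := psi) Me Ma) as (b & Mb & Hb).
{ intros x Mx Hx y y' My My'; rewrite !Hpsi; trivial; eauto. }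
exists b; split; [exact Mb|].
intros y My; rewrite (Hb y My); split.
- intros (x & Mx & Hx & Hs); exists x; rewrite <- Hpsi; auto.
- intros (x & Hx & Hs); exists x; rewrite Hpsi; eauto.
Qed.

(** Replacement for the map that sends [x] to the set of all [y] with [P x y], followed by a union.
    It serves for relations that are not functional. *)
Lemma replacement_union (P : V -> V -> Prop) a :
  definable M (fun e => P (e 0) (e 1)) -> M a ->
  (forall x, x ∈ a -> exists s, M s /\ forall y, M y -> (y ∈ s <-> P x y)) ->
  exists b, M b /\ forall y, M y -> (y ∈ b <-> exists x, x ∈ a /\ P x y).
Proof.
intros HP Ma Hs.
destruct (replacement (fun x s => forall y, M y -> (y ∈ s <-> P x y)) a) as (b & Mb & Hb);
  trivial.
- definability.
- intros x y y' Hx My My' H H'; apply M_ext; trivial.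
  intros z Mz; rewrite H, H'; tauto.
- destruct (zf_union M_ZF Mb) as (c & Mc & Hc).
  exists c; split; [exact Mc|].
  intros y My; rewrite (Hc y My); split.
  + intros (s & Ms & Hsb & Hys); apply Hb in Hsb; trivial.
    destruct Hsb as (x & Hx & Hsx); exists x; split; [exact Hx|]; apply Hsx; trivial.
  + intros (x & Hx & HPx); destruct (Hs x Hx) as (s & Ms & Hsx).
    exists s; repeat split; trivial; [|apply Hsx; trivial].
    apply Hb; trivial; eauto.
Qed.

(** * Unions, pairs and the definability of basic notions *)

Lemma union_exists x : M x ->
  exists u, M u /\ forall z, z ∈ u <-> exists y, y ∈ x /\ z ∈ y.
Proof.
intros Mx; destruct (zf_union M_ZF Mx) as (u & Mu & Hu).
exists u; split; [exact Mu|]; intros z; split.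
- intros Hz; apply Hu in Hz; [|eauto]; destruct Hz as (y & _ & Hy); eauto.
- intros (y & Hy & Hz); apply Hu; eauto 6.
Qed.

Lemma upair_exists x y : M x -> M y -> exists p, M p /\ is_upair p x y.
Proof.
intros Mx My; destruct (zf_pairing M_ZF Mx My) as (p & Mp & Hp).
exists p; split; [exact Mp|]; intros z; split.
- intros Hz; apply Hp; eauto.
- intros Hz; apply Hp; [|exact Hz]; destruct Hz; congruence.
Qed.

Lemma adjoin_exists x y : M x -> M y ->
  exists z, M z /\ forall w, w ∈ z <-> w ∈ x \/ w = y.
Proof.
intros Mx My.
destruct (upair_exists y y My My) as (s & Ms & Hs).
destruct (upair_exists x s Mx Ms) as (p & Mp & Hp).
destruct (union_exists p Mp) as (u & Mu & Hu).
exists u; split; [exact Mu|]; intros w; rewrite Hu; split.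
- intros (t & Ht & Hw); apply Hp in Ht; destruct Ht; subst; [auto|].
  apply Hs in Hw; tauto.
- intros [Hw|Hw]; [exists x|exists s]; split; trivial; [apply Hp; auto| |].
  + apply Hp; auto.
  + apply Hs; auto.
Qed.

Lemma upair_unique (p q x y : V) : is_upair p x y -> is_upair q x y -> p = q.
Proof. intros Hp Hq; apply mem_ext; intros z; rewrite (Hp z), (Hq z); tauto. Qed.

Lemma pair_unique (p q x y : V) : is_pair p x y -> is_pair q x y -> p = q.
Proof. intros Hp Hq; apply mem_ext; intros z; rewrite (Hp z), (Hq z); tauto. Qed.

Lemma pair_exists x y : M x -> M y -> exists p, M p /\ is_pair p x y.
Proof.
intros Mx My.
destruct (upair_exists x x Mx Mx) as (s & Ms & Hs).
destruct (upair_exists x y Mx My) as (t & Mt & Ht).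
destruct (upair_exists s t Ms Mt) as (p & Mp & Hp).
exists p; split; [exact Mp|]; intros z; rewrite (Hp z); split.
- intros [->| ->]; auto.
- intros [H|H]; [left|right]; eapply upair_unique; eassumption.
Qed.

Lemma pair_M p x y : M x -> M y -> is_pair p x y -> M p.
Proof.
intros Mx My Hp; destruct (pair_exists x y Mx My) as (q & Mq & Hq).
now rewrite (pair_unique p q x y).
Qed.

(** The universe need not be closed under pairing, so the singletons and unordered pairs of the
    usual argument are taken from [M]. *)
Lemma pair_inj p x y x' y' : M x -> M y -> M x' -> M y' ->
  is_pair p x y -> is_pair p x' y' -> x = x' /\ y = y'.
Proof.
intros Mx My Mx' My' Hp Hp'.
assert (Hx : x = x').
{ destruct (upair_exists x x Mx Mx) as (s & Ms & Hs).
  assert (Hsp : s ∈ p) by (apply Hp; auto).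
  apply Hp' in Hsp.
  assert (Hx' : x' ∈ s) by (destruct Hsp as [H|H]; apply H; auto).
  apply Hs in Hx'; destruct Hx'; auto. }
subst x'; split; [reflexivity|].
assert (Hy : y = x \/ y = y').
{ destruct (upair_exists x y Mx My) as (s & Ms & Hs).
  assert (Hsp : s ∈ p) by (apply Hp; auto).
  apply Hp' in Hsp; destruct Hsp as [H|H].
  - assert (Hys : y ∈ s) by (apply Hs; auto); apply H in Hys; tauto.
  - assert (Hys : y ∈ s) by (apply Hs; auto); apply H in Hys; tauto. }
assert (Hy' : y' = x \/ y' = y).
{ destruct (upair_exists x y' Mx My') as (s & Ms & Hs).
  assert (Hsp : s ∈ p) by (apply Hp'; auto).
  apply Hp in Hsp; destruct Hsp as [H|H].
  - assert (Hys : y' ∈ s) by (apply Hs; auto); apply H in Hys; tauto.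
  - assert (Hys : y' ∈ s) by (apply Hs; auto); apply H in Hys; tauto. }
destruct Hy, Hy'; congruence.
Qed.

(** The quantifier in [is_upair] ranges over the universe. Restricting it to [M] changes nothing,
    since both sides of the equivalence only hold of elements of [M]. *)
Lemma definable_upair : definable M (fun e => is_upair (e 0) (e 1) (e 2)).
Proof.
apply definable_equiv with
  (fun e => forall z, M z -> (z ∈ e 0 <-> z = e 1 \/ z = e 2)); [|definability].
intros e He; split; intros H z; [|auto].
split; [intros Hz; apply H; eauto | intros Hz; apply H; [|exact Hz]].
destruct Hz; subst; auto.
Qed.

Lemma definable_pair : definable M (fun e => is_pair (e 0) (e 1) (e 2)).
Proof.
pose proof definable_upair as HU.
apply definable_equiv with
  (fun e => forall z, M z ->
     (z ∈ e 0 <-> is_upair z (e 1) (e 1) \/ is_upair z (e 1) (e 2))); [|definability].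
intros e He; split; intros H z; [|auto].
assert (Hu : forall x y, M x -> M y -> is_upair z x y -> M z).
{ intros x y Mx My Hz; destruct (upair_exists x y Mx My) as (s & Ms & Hs).
  now rewrite (upair_unique z s x y). }
split; [intros Hz; apply H; eauto | intros Hz; apply H; [|exact Hz]].
destruct Hz; eauto.
Qed.

Lemma definable_pair_in : definable M (fun e => pair_in (e 0) (e 1) (e 2)).
Proof. pose proof definable_pair; unfold pair_in; definability. Qed.

Lemma definable_transitive_set : definable M (fun e => transitive_set (e 0)).
Proof.
apply definable_equiv with (fun e => forall y, y ∈ e 0 -> forall z, z ∈ y -> z ∈ e 0);
  [|definability].
intros e _; split; intros H y; [intros z Hy|intros Hy z]; apply H; exact Hy.
Qed.

Lemma definable_ordinal : definable M (fun e => is_ordinal (e 0)).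
Proof.
pose proof definable_transitive_set.
apply definable_equiv with (fun e => transitive_set (e 0) /\
  forall y, y ∈ e 0 -> forall z, z ∈ e 0 -> y ∈ z \/ y = z \/ z ∈ y);
  [|definability].
intros e _; split; intros [H1 H2]; split; auto.
Qed.

(** * Recursion along a set-like well-founded relation *)

Section Recursion.
Variables (R K : V -> V -> Prop).

(** [recursion a u] says that [u] is the value at [a] of the function [F] with
    [F a = {y | exists d, R d a /\ K (F d) y}]. *)
Inductive recursion : V -> V -> Prop :=
  recursion_intro a u :
    (forall d, R d a -> exists v, recursion d v /\ forall y, K v y -> y ∈ u) ->
    (forall y, y ∈ u -> exists d v, R d a /\ recursion d v /\ K v y) ->
    recursion a u.

Lemma recursion_functional a : Acc R a -> forall u u',
  recursion a u -> recursion a u' -> u = u'.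
Proof.
induction 1 as [a _ IH].
assert (Hsub : forall u u' y, recursion a u -> recursion a u' -> y ∈ u -> y ∈ u').
{ intros u u' y H H' Hy; inversion H as [? ? _ Hu]; subst.
  inversion H' as [? ? Hu' _]; subst.
  destruct (Hu y Hy) as (d & v & Hd & Hv & HK).
  destruct (Hu' d Hd) as (v' & Hv' & HK'); apply HK'.
  now rewrite <- (IH d Hd v v' Hv Hv'). }
intros u u' H H'; apply mem_ext; intros y; split; eauto.
Qed.

Lemma recursion_total_step a u : recursion a u -> forall d, R d a -> exists v, recursion d v.
Proof. intros H d Hd; inversion H as [? ? Hu _]; destruct (Hu d Hd) as (v & Hv & _); eauto. Qed.

Lemma recursion_mem a u : Acc R a -> recursion a u ->
  forall y, y ∈ u <-> exists d v, R d a /\ recursion d v /\ K v y.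
Proof.
intros Ha H y; inversion H as [? ? Hu Hu']; subst; split; [auto|].
intros (d & v & Hd & Hv & HK); destruct (Hu d Hd) as (v' & Hv' & HK').
apply HK'; rewrite <- (recursion_functional d (Acc_inv Ha Hd) v v' Hv Hv'); exact HK.
Qed.

Hypothesis R_def : definable M (fun e => R (e 0) (e 1)).
Hypothesis K_def : definable M (fun e => K (e 0) (e 1)).
Hypothesis R_wf : forall a, M a -> Acc R a.
Hypothesis R_set : forall a, M a -> exists p, M p /\ forall d, d ∈ p <-> R d a.
Hypothesis K_set : forall v, M v -> exists k, M k /\ forall y, y ∈ k <-> K v y.

Lemma R_M d a : M a -> R d a -> M d.
Proof. intros Ma Hd; destruct (R_set a Ma) as (p & Mp & Hp); apply Hp in Hd; eauto. Qed.

Lemma K_M v y : M v -> K v y -> M y.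
Proof. intros Mv Hy; destruct (K_set v Mv) as (p & Mp & Hp); apply Hp in Hy; eauto. Qed.

(** A partial solution of the recursion whose domain is closed under predecessors. The quantifiers
    are bounded to [M] to make the notion definable there. *)
Definition attempt (g : V) : Prop :=
  forall a, M a -> forall u, M u -> pair_in g a u ->
    (forall d, M d -> R d a ->
       exists v, M v /\ (pair_in g d v /\ forall y, M y -> K v y -> y ∈ u)) /\
    (forall y, y ∈ u ->
       exists d, M d /\ exists v, M v /\ (R d a /\ pair_in g d v /\ K v y)).

Definition defined_at (g a : V) : Prop := exists u, M u /\ pair_in g a u.

(* Leastness makes the attempt at [a] unique, so that replacement applies to it. *)
Definition least_attempt (a g : V) : Prop :=
  (attempt g /\ defined_at g a) /\
  forall g', M g' -> attempt g' /\ defined_at g' a -> forall p, p ∈ g -> p ∈ g'.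

Lemma definable_attempt : definable M (fun e => attempt (e 0)).
Proof. pose proof definable_pair_in; unfold attempt; definability. Qed.

Lemma definable_defined_at : definable M (fun e => defined_at (e 0) (e 1)).
Proof. pose proof definable_pair_in; unfold defined_at; definability. Qed.

Lemma definable_least_attempt : definable M (fun e => least_attempt (e 0) (e 1)).
Proof.
pose proof definable_attempt; pose proof definable_defined_at.
unfold least_attempt; definability.
Qed.

Lemma attempt_sound g : attempt g -> forall a, M a -> forall u, M u ->
  pair_in g a u -> recursion a u.
Proof.
intros Hg a Ma; induction (R_wf a Ma) as [a _ IH]; intros u Mu Hau.
destruct (Hg a Ma u Mu Hau) as [H1 H2]; constructor.
- intros d Hd; assert (Md : M d) by exact (R_M d a Ma Hd).
  destruct (H1 d Md Hd) as (v & Mv & Hv & HK); exists v; split; [eauto|].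
  intros y Hy; apply HK; trivial; exact (K_M v y Mv Hy).
- intros y Hy; destruct (H2 y Hy) as (d & Md & v & Mv & Hd & Hv & HK).
  exists d, v; eauto.
Qed.

Lemma pair_in_sub (g g' a u : V) : (forall p, p ∈ g -> p ∈ g') ->
  pair_in g a u -> pair_in g' a u.
Proof. intros H (p & Hp & Hpa); exists p; auto. Qed.

(** By induction along [R]: the least attempts at the predecessors of [a] are collected into their
    union [G], the value [u] at [a] is computed from [G], and the pair of [a] and [u] is
    adjoined. *)
Lemma least_attempt_exists a : M a -> exists g, M g /\ least_attempt a g.
Proof.
intros Ma; induction (R_wf a Ma) as [a _ IH].
assert (IH' : forall d, R d a -> exists g, M g /\ least_attempt d g).
{ intros d Hd; apply IH; [exact Hd|]; exact (R_M d a Ma Hd). }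
clear IH; pose proof definable_least_attempt as HL; pose proof definable_pair_in as HPI.
destruct (R_set a Ma) as (pa & Mpa & Hpa).
destruct (replacement_union (fun d p => exists g, M g /\ (least_attempt d g /\ p ∈ g)) pa)
  as (G & MG & HG); trivial.
{ definability. }
{ intros d Hd; apply Hpa in Hd; destruct (IH' d Hd) as (g & Mg & Hg).
  exists g; split; [exact Mg|]; intros p Mp; split; [eauto|].
  intros (g' & Mg' & Hg' & Hp); apply (proj2 Hg' g Mg (proj1 Hg) p Hp). }
assert (HGsub : forall d g, R d a -> M g -> least_attempt d g -> forall p, p ∈ g -> p ∈ G).
{ intros d g Hd Mg Hg p Hp; apply HG; [eauto|].
  exists d; split; [apply Hpa; exact Hd | eauto]. }
assert (HGdom : forall d, R d a -> exists v, M v /\ pair_in G d v).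
{ intros d Hd; destruct (IH' d Hd) as (g & Mg & Hg).
  destruct (proj2 (proj1 Hg)) as (v & Mv & Hv); exists v; split; [exact Mv|].
  exact (pair_in_sub g G d v (HGsub d g Hd Mg Hg) Hv). }
assert (HGatt : attempt G).
{ intros b Mb u Mu (p & Hp & Hpbu); assert (Mp : M p) by eauto.
  apply HG in Hp; trivial; destruct Hp as (d & Hd & g & Mg & Hg & Hp); apply Hpa in Hd.
  assert (Hsub := HGsub d g Hd Mg Hg).
  destruct (proj1 (proj1 Hg) b Mb u Mu) as [H1 H2]; [exists p; auto|]; split.
  - intros c Mc Hc; destruct (H1 c Mc Hc) as (v & Mv & Hv & HK).
    exists v; repeat split; trivial; now apply (pair_in_sub g).
  - intros y Hy; destruct (H2 y Hy) as (c & Mc & v & Mv & Hc & Hv & HK).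
    exists c; split; [exact Mc|]; exists v; repeat split; trivial; now apply (pair_in_sub g). }
destruct (replacement_union (fun d y => exists v, M v /\ (pair_in G d v /\ K v y)) pa)
  as (u & Mu & Hu); trivial.
{ definability. }
{ intros d Hd; apply Hpa in Hd; destruct (HGdom d Hd) as (v & Mv & Hv).
  destruct (K_set v Mv) as (k & Mk & Hk); exists k; split; [exact Mk|].
  intros y My; rewrite (Hk y); split; [eauto|].
  intros (v' & Mv' & Hv' & HK); assert (Md : M d) by exact (R_M d a Ma Hd).
  rewrite (recursion_functional d (R_wf d Md) v v'); trivial;
    apply (attempt_sound G); trivial. }
destruct (pair_exists a u Ma Mu) as (q & Mq & Hq).
destruct (adjoin_exists G q MG Mq) as (g & Mg & Hg).
assert (HgG : forall p, p ∈ G -> p ∈ g) by (intros p Hp; apply Hg; auto).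
assert (Hgau : pair_in g a u) by (exists q; split; trivial; apply Hg; auto).
assert (Hgatt : attempt g).
{ intros b Mb v Mv (p & Hp & Hpbv).
  apply Hg in Hp; destruct Hp as [Hp|Hp].
  - destruct (HGatt b Mb v Mv) as [H1 H2]; [exists p; auto|]; split.
    + intros c Mc Hc; destruct (H1 c Mc Hc) as (w & Mw & Hw & HK).
      exists w; repeat split; trivial; now apply (pair_in_sub G).
    + intros y Hy; destruct (H2 y Hy) as (c & Mc & w & Mw & Hc & Hw & HK).
      exists c; split; [exact Mc|]; exists w; repeat split; trivial; now apply (pair_in_sub G).
  - subst p; destruct (pair_inj q b v a u Mb Mv Ma Mu Hpbv Hq); subst b v; split.
    + intros d Md Hd; destruct (HGdom d Hd) as (v & Mv' & Hv).
      exists v; repeat split; trivial; [now apply (pair_in_sub G)|].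
      intros y My Hy; apply Hu; trivial; exists d; split; [apply Hpa; exact Hd | eauto].
    + intros y Hy; apply Hu in Hy; [|eauto].
      destruct Hy as (d & Hd & w & Mw & Hw & HK); exists d; split; [eauto|].
      exists w; repeat split; trivial; [apply Hpa; exact Hd | now apply (pair_in_sub G)]. }
exists g; split; [exact Mg|]; split; [split; [exact Hgatt | exists u; auto]|].
(* An attempt defined at [a] is defined at all predecessors of [a], so it contains their least
   attempts and thus [G]; its value at [a] is [u] by uniqueness. *)
intros g' Mg' [Hg' (u' & Mu' & Hu')] p Hp; apply Hg in Hp; destruct Hp as [Hp|Hp].
- assert (Mp : M p) by eauto.
  apply HG in Hp; trivial; destruct Hp as (d & Hd & h & Mh & Hh & Hp); apply Hpa in Hd.
  assert (Md : M d) by exact (R_M d a Ma Hd).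
  destruct (proj1 (Hg' a Ma u' Mu' Hu') d Md Hd) as (v & Mv & Hv & _).
  apply (proj2 Hh g' Mg'); trivial; split; trivial; exists v; auto.
- subst p; assert (E : u' = u).
  { apply (recursion_functional a (R_wf a Ma));
      [apply (attempt_sound g') | apply (attempt_sound g)]; trivial. }
  subst u'; destruct Hu' as (p & Hp & Hpau).
  now rewrite (pair_unique q p a u).
Qed.

Lemma recursion_exists a : M a -> exists u, M u /\ recursion a u.
Proof.
intros Ma; destruct (least_attempt_exists a Ma) as (g & Mg & [Hg (u & Mu & Hu)] & _).
exists u; split; [exact Mu|]; now apply (attempt_sound g).
Qed.

(** The inductive predicate lives outside [M], but it agrees on [M] with the existence of an attempt
    in [M] that has the given value. *)
Lemma definable_recursion : definable M (fun e => recursion (e 0) (e 1)).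
Proof.
pose proof definable_attempt; pose proof definable_pair_in.
apply definable_equiv with
  (fun e => exists g, M g /\ (attempt g /\ pair_in g (e 0) (e 1))); [|definability].
intros e He; split.
- intros (g & Mg & Hg & Hp); apply (attempt_sound g); trivial.
- intros Hr; destruct (least_attempt_exists (e 0) (He 0)) as (g & Mg & [Hg (u & Mu & Hu)] & _).
  exists g; split; [exact Mg|]; split; [exact Hg|].
  now rewrite (recursion_functional _ (R_wf _ (He 0)) (e 1) u Hr
    (attempt_sound g Hg _ (He 0) u Mu Hu)).
Qed.

End Recursion.
End Model.

(** * Ordinals and levels *)

Section Ordinals.
Context {V : set_universe}.
Implicit Types x y z a b c : V.

Lemma mem_irrefl x : ~ x ∈ x.
Proof. induction (mem_wf x) as [x _ IH]; intros H; exact (IH x H H). Qed.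

Lemma mem_asym x y : x ∈ y -> ~ y ∈ x.
Proof.
revert y; induction (mem_wf x) as [x _ IH]; intros y H H'; exact (IH y H' x H' H).
Qed.

Lemma mem_no_cycle3 x y z : x ∈ y -> y ∈ z -> ~ z ∈ x.
Proof.
revert y z; induction (mem_wf x) as [x _ IH]; intros y z H H' H''.
exact (IH z H'' x y H'' H H').
Qed.

Lemma mem_minimal (P : V -> Prop) : (exists x, P x) ->
  exists x, P x /\ forall y, y ∈ x -> ~ P y.
Proof.
intros (x & Px); apply NNPP; intros H; revert Px.
induction (mem_wf x) as [x _ IH]; intros Px; apply H; exists x; eauto.
Qed.

Lemma nonempty_mem a : ~ is_empty a -> exists b, b ∈ a.
Proof. intros H; apply NNPP; intros H'; apply H; intros b Hb; eauto. Qed.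

Lemma ordinal_mem x y : is_ordinal x -> y ∈ x -> is_ordinal y.
Proof.
intros [Ht Hl] Hy; split.
- intros z w Hz Hw.
  destruct (Hl w y) as [H|[->|H]]; trivial.
  + exact (Ht z w (Ht y z Hy Hz) Hw).
  + destruct (mem_asym _ _ Hz Hw).
  + destruct (mem_no_cycle3 _ _ _ Hw Hz H).
- intros z w Hz Hw; apply Hl; eapply Ht; eassumption.
Qed.

Lemma ordinal_trichotomy a b : is_ordinal a -> is_ordinal b ->
  a ∈ b \/ a = b \/ b ∈ a.
Proof.
revert b; induction (mem_wf a) as [a _ IHa]; intros b.
induction (mem_wf b) as [b _ IHb]; intros Ha Hb.
destruct (classic (b ∈ a)) as [|Hba]; [auto|].
destruct (classic (a ∈ b)) as [|Hab]; [auto|].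
right; left; apply mem_ext; intros c; split; intros Hc.
- destruct (IHa c Hc b) as [H|[->|H]]; trivial; try easy.
  + exact (ordinal_mem _ _ Ha Hc).
  + destruct Hba; exact (proj1 Ha c b Hc H).
- destruct (IHb c Hc) as [H|[->|H]]; trivial; try easy.
  + exact (ordinal_mem _ _ Hb Hc).
  + destruct Hab; exact (proj1 Hb c a Hc H).
Qed.

Lemma ordinal_intro x :
  transitive_set x -> (forall y, y ∈ x -> is_ordinal y) -> is_ordinal x.
Proof. intros Ht Ho; split; [exact Ht|]; intros; apply ordinal_trichotomy; auto. Qed.

Lemma ordinal_sub_max a b c : is_ordinal a -> b ∈ a -> c ∈ a ->
  exists d, d ∈ a /\ (forall x, x ∈ b -> x ∈ d) /\ (forall x, x ∈ c -> x ∈ d).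
Proof.
intros Ha Hb Hc.
destruct (proj2 Ha b c Hb Hc) as [H|[<-|H]]; [exists c|exists b|exists b];
  repeat split; trivial; intros x Hx; eapply ordinal_mem; eauto.
Qed.

(** The successor is found inside [a], as the least element above [b]; if nothing in [a] were above
    [b], then [a] would be the successor of [b]. *)
Lemma limit_succ a b : is_limit a -> b ∈ a -> exists c, c ∈ a /\ is_succ b c.
Proof.
intros (Ha & _ & Hns) Hb.
destruct (mem_minimal (fun c => c ∈ a /\ b ∈ c)) as (c & [Hc Hbc] & Hmin).
- apply NNPP; intros H; apply Hns; exists b; intros y; split.
  + intros Hy; destruct (proj2 Ha y b Hy Hb) as [|[|]]; [auto..|].
    destruct H; eauto.
  + intros [Hy| ->]; [exact (proj1 Ha b y Hb Hy) | exact Hb].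
- exists c; split; [exact Hc|]; intros y; split.
  + intros Hy; assert (Hya : y ∈ a) by exact (proj1 Ha c y Hc Hy).
    destruct (proj2 Ha y b Hya Hb) as [|[|]]; [auto..|].
    destruct (Hmin y Hy); auto.
  + intros [Hy| ->]; [|exact Hbc].
    exact (proj1 (ordinal_mem _ _ Ha Hc) b y Hbc Hy).
Qed.

(** A model-free form of [alpha_set_in], with the successor and the limit
    clauses merged. *)
Inductive level : V -> V -> Prop :=
| level_empty a x : is_empty a -> (forall y, y ∈ x -> is_ordinal y) -> level a x
| level_step a x : ~ is_empty a ->
    (forall y, y ∈ x -> exists b, b ∈ a /\ level b y) -> level a x.

Lemma level_ordinal o : is_ordinal o -> forall a, level a o.
Proof.
induction (mem_wf o) as [o _ IH]; intros Ho a.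
destruct (classic (is_empty a)) as [Ha|Ha].
- apply level_empty; trivial; intros y Hy; exact (ordinal_mem _ _ Ho Hy).
- destruct (nonempty_mem a Ha) as (b & Hb).
  apply level_step; trivial; intros y Hy; exists b; split; trivial.
  apply IH; trivial; exact (ordinal_mem _ _ Ho Hy).
Qed.

(** The case to check is [b] empty and [a] nonempty: the elements of [x] are then ordinals, and
    ordinals have every level. *)
Lemma level_mono a b x : (forall c, c ∈ b -> c ∈ a) -> level b x -> level a x.
Proof.
intros Hba Hx; destruct (classic (is_empty a)) as [Ha|Ha].
- destruct Hx as [b x Hb Hx|b x Hb Hx]; [now apply level_empty|].
  destruct Hb; intros c Hc; exact (Ha c (Hba c Hc)).
- apply level_step; trivial; intros y Hy.
  destruct Hx as [b x Hb Hx|b x Hb Hx].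
  + destruct (nonempty_mem a Ha) as (c & Hc); exists c; split; trivial.
    apply level_ordinal; auto.
  + destruct (Hx y Hy) as (c & Hc & Hl); eauto.
Qed.

Lemma level_subset a x x' : (forall y, y ∈ x' -> y ∈ x) -> level a x -> level a x'.
Proof.
intros H Hx; destruct Hx as [a x Ha Hx|a x Ha Hx];
  [apply level_empty | apply level_step]; auto.
Qed.

Lemma level_mem a b x y : is_ordinal a -> b ∈ a -> level b x -> y ∈ x ->
  exists c, c ∈ a /\ level c y.
Proof.
intros Ha Hb Hx Hy; destruct Hx as [b x He Hx|b x He Hx].
- exists b; split; trivial; apply level_ordinal; auto.
- destruct (Hx y Hy) as (c & Hc & Hl); exists c; split; trivial.
  exact (proj1 Ha b c Hb Hc).
Qed.

(** In the limit case an element of [x] belongs to some [B] of level below [a], so it has itself a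
    level below [a]. *)
Lemma alpha_set_level (M : class V) a :
  is_ordinal a -> forall x, alpha_set_in M a x -> level a x.
Proof.
induction (mem_wf a) as [a _ IH]; intros Ha x Hx.
destruct Hx as [a x He Hx|a b x Hs Hx|a x A Hl MA HU HA].
- now apply level_empty.
- assert (Hb : b ∈ a) by (apply Hs; auto).
  apply level_step; [intros He; exact (He b Hb)|].
  intros y Hy; exists b; split; trivial; apply IH; auto.
  exact (ordinal_mem _ _ Ha Hb).
- apply level_step; [apply Hl|].
  intros y Hy; apply HU in Hy; destruct Hy as (B & HB & Hy).
  destruct (HA B HB) as (b & Hb & Hlb).
  apply (level_mem a b B y); trivial; apply IH; trivial.
  exact (ordinal_mem _ _ Ha Hb).
Qed.

(** If [a] is a successor, all elements can be raised to its predecessor. If [a] is a limit, [x] is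
    the union of the singletons of its elements, a family that exists in [M] by replacement; the
    singleton of a set of level [b] has level [b + 1], still below [a]. *)
Lemma level_alpha_set (M : class V) : transitive_class M -> models_ZF M ->
  forall a, is_ordinal a -> forall x, M x -> level a x -> alpha_set_in M a x.
Proof.
intros HT HZ a; induction (mem_wf a) as [a _ IH]; intros Ha x Mx Hx.
destruct Hx as [a x He Hx|a x He Hx]; [now apply alpha_set_zero|].
destruct (classic (exists b, is_succ b a)) as [(b & Hs)|Hns].
- assert (Hb : b ∈ a) by (apply Hs; auto).
  apply alpha_set_succ with b; trivial; intros y Hy.
  apply IH; trivial; [exact (ordinal_mem _ _ Ha Hb) | eauto |].
  destruct (Hx y Hy) as (c & Hc & Hl); apply (level_mono b c); trivial.
  apply Hs in Hc; destruct Hc as [Hc| ->]; auto.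
  intros d Hd; exact (proj1 (ordinal_mem _ _ Ha Hb) c d Hc Hd).
- assert (Hlim : is_limit a) by (repeat split; auto; apply Ha).
  destruct (replacement M HT HZ (fun y s => is_upair s y y) x) as (A & MA & HA); trivial.
  { pose proof (definable_upair M HT). definability. }
  { intros y s s' _ _ _ H H'; exact (upair_unique s s' y y H H'). }
  assert (HA' : forall s, s ∈ A <-> exists y, y ∈ x /\ is_upair s y y).
  { intros s; split; [intros Hs; apply HA; eauto|].
    intros (y & Hy & Hs); apply HA; [|eauto].
    destruct (upair_exists M HT HZ y y) as (s' & Ms' & Hs'); eauto.
    now rewrite (upair_unique s s' y y Hs Hs'). }
  apply alpha_set_limit with A; trivial.
  + intros y; split.
    * intros Hy; destruct (upair_exists M HT HZ y y) as (s & Ms & Hs); eauto.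
      exists s; split; [apply HA'; eauto | apply Hs; auto].
    * intros (s & Hs & Hy); apply HA' in Hs; destruct Hs as (z & Hz & Hs).
      apply Hs in Hy; destruct Hy; subst; trivial.
  + intros s Hs; apply HA' in Hs; destruct Hs as (y & Hy & Hs).
    destruct (Hx y Hy) as (b & Hb & Hl).
    destruct (limit_succ a b Hlim Hb) as (c & Hc & Hbc).
    exists c; split; trivial; apply alpha_set_succ with b; trivial.
    intros z Hz; assert (z = y) by (apply Hs in Hz; tauto); subst z.
    apply IH; trivial; [exact (ordinal_mem _ _ Ha Hb) | eauto].
Qed.

End Ordinals.

(** * Ranks and pairs of ordinals *)

(** The usual rank, the supremum of [rank d + 1] over the elements [d]. It mentions no model, so
    ranks computed in [M] and in [N] agree. *)
Definition rank_value {V : set_universe} : V -> V -> Prop :=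
  recursion (@mem V) (fun v y => y ∈ v \/ y = v).

Lemma rank_ordinal {V : set_universe} (x : V) : forall r, rank_value x r -> is_ordinal r.
Proof.
induction (mem_wf x) as [x _ IH]; intros r Hr.
assert (Hmem := recursion_mem _ _ x r (mem_wf x) Hr).
apply ordinal_intro.
- intros y z Hy Hz; apply Hmem in Hy; destruct Hy as (d & v & Hd & Hv & Hy).
  apply Hmem; exists d, v; repeat apply conj; trivial; left.
  destruct Hy as [Hy| ->]; [|exact Hz].
  exact (proj1 (IH d Hd v Hv) y z Hy Hz).
- intros y Hy; apply Hmem in Hy; destruct Hy as (d & v & Hd & Hv & [Hy| ->]).
  + exact (ordinal_mem _ _ (IH d Hd v Hv) Hy).
  + exact (IH d Hd v Hv).
Qed.

Definition lex {V : set_universe} (S p q : V) : Prop :=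
  exists a, a ∈ S /\ exists b, b ∈ S /\ exists c, c ∈ S /\ exists d, d ∈ S /\
    (is_pair p a b /\ is_pair q c d /\ (a ∈ c \/ a = c /\ b ∈ d)).

(** For an ordinal [S], the order isomorphism from the lexicographic order on
    [S * S] to an ordinal. *)
Definition lex_code {V : set_universe} (S a b c : V) : Prop :=
  exists p, is_pair p a b /\ recursion (lex S) (fun v y => y = v) p c.

(** * Bounds of ordinals, the cumulative hierarchy and ranks inside a model *)

Section Constructions.
Context {V : set_universe} (M : class V).
Hypothesis M_trans : transitive_class M.
Hypothesis M_ZF : models_ZF M.

(** The bound is the supremum of [o + 1] over the ordinals [o] in [x]. *)
Lemma ordinal_bound x : M x ->
  exists k, M k /\ is_ordinal k /\ forall o, o ∈ x -> is_ordinal o -> o ∈ k.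
Proof.
intros Mx.
destruct (separation M M_trans M_ZF (@is_ordinal V) x) as (x0 & Mx0 & Hx0); trivial.
{ exact (definable_ordinal M M_trans). }
destruct (replacement_union M M_trans M_ZF (fun o w => w ∈ o \/ w = o) x0)
  as (k & Mk & Hk); trivial.
{ definability. }
{ intros o Ho; destruct (adjoin_exists M M_trans M_ZF o o) as (s & Ms & Hs); eauto. }
exists k; split; [exact Mk|]; split.
- apply ordinal_intro.
  + intros y z Hy Hz; apply Hk; [eauto|].
    apply Hk in Hy; [|eauto]; destruct Hy as (o & Ho & Hy).
    exists o; split; trivial; left; apply Hx0 in Ho.
    destruct Hy as [Hy| ->]; trivial; exact (proj1 (proj2 Ho) y z Hy Hz).
  + intros y Hy; apply Hk in Hy; [|eauto]; destruct Hy as (o & Ho & Hy).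
    apply Hx0 in Ho; destruct Hy as [Hy| ->]; [|tauto].
    exact (ordinal_mem _ _ (proj2 Ho) Hy).
- intros o Ho Hoo; apply Hk; [eauto|]; exists o; split; [apply Hx0|]; auto.
Qed.

Lemma binary_union_exists x y : M x -> M y ->
  exists z, M z /\ forall w, w ∈ z <-> w ∈ x \/ w ∈ y.
Proof.
intros Mx My; destruct (upair_exists M M_trans M_ZF x y Mx My) as (p & Mp & Hp).
destruct (union_exists M M_trans M_ZF p Mp) as (u & Mu & Hu).
exists u; split; [exact Mu|]; intros w; rewrite Hu; split.
- intros (s & Hs & Hw); apply Hp in Hs; destruct Hs; subst; auto.
- intros [Hw|Hw]; [exists x|exists y]; split; trivial; apply Hp; auto.
Qed.

Lemma singleton_set v : M v -> exists k, M k /\ forall y, y ∈ k <-> y = v.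
Proof.
intros Mv; destruct (upair_exists M M_trans M_ZF v v Mv Mv) as (k & Mk & Hk).
exists k; split; trivial; intros y; rewrite (Hk y); tauto.
Qed.

Definition subset_in (v y : V) : Prop := M y /\ forall z, z ∈ y -> z ∈ v.

(** The cumulative hierarchy of [M], indexed by arbitrary sets:
    its value at [a] is the union of the power sets of the values at [d ∈ a]. *)
Definition hierarchy : V -> V -> Prop := recursion (@mem V) subset_in.

Lemma definable_mem01 : definable M (fun e => e 0 ∈ e 1).
Proof. definability. Qed.

Lemma definable_subset_in : definable M (fun e => subset_in (e 0) (e 1)).
Proof.
apply definable_equiv with (fun e => forall z, z ∈ e 1 -> z ∈ e 0); [|definability].
intros e He; split; [split|]; trivial; intros H; apply H.
Qed.

Lemma subset_in_set v : M v -> exists k, M k /\ forall y, y ∈ k <-> subset_in v y.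
Proof.
intros Mv; destruct (zf_power M_ZF Mv) as (k & Mk & Hk).
exists k; split; [exact Mk|]; intros y; split.
- intros Hy; assert (My : M y) by eauto; split; [exact My|].
  intros z Hz; apply (proj1 (Hk y My) Hy); eauto.
- intros [My Hy]; apply Hk; auto.
Qed.

Lemma hierarchy_exists a : M a -> exists u, M u /\ hierarchy a u.
Proof.
apply recursion_exists; trivial.
- exact definable_mem01.
- exact definable_subset_in.
- intros; apply mem_wf.
- intros x Mx; exists x; split; trivial; tauto.
- exact subset_in_set.
Qed.

Lemma hierarchy_mem a u y : hierarchy a u ->
  (y ∈ u <-> exists d v, d ∈ a /\ hierarchy d v /\ subset_in v y).
Proof. intros Hu; exact (recursion_mem _ _ a u (mem_wf a) Hu y). Qed.

(** Because the index may be any set, this is a plain membership induction: an element [x] of [a] is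
    a subset of the value at [x]. *)
Lemma hierarchy_subset a : M a -> forall u, hierarchy a u -> forall x, x ∈ a -> x ∈ u.
Proof.
induction (mem_wf a) as [a _ IH]; intros Ma u Hu x Hx.
assert (Mx : M x) by eauto.
destruct (hierarchy_exists x Mx) as (v & Mv & Hv).
apply (hierarchy_mem a u x Hu); exists x, v; repeat apply conj; trivial.
exact (IH x Hx Mx v Hv).
Qed.

Lemma hierarchy_transitive a : forall u, hierarchy a u -> transitive_set u.
Proof.
induction (mem_wf a) as [a _ IH]; intros u Hu y z Hy Hz.
apply (hierarchy_mem a u y Hu) in Hy; destruct Hy as (d & v & Hd & Hv & My & Hy).
apply (hierarchy_mem a u z Hu); exists d, v; repeat apply conj; trivial; [eauto|].
intros w Hw; exact (IH d Hd v Hv z w (Hy z Hz) Hw).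
Qed.

(** The value of the hierarchy at the singleton of [x] takes the place of a transitive closure. *)
Lemma transitive_set_containing x : M x -> exists t, M t /\ transitive_set t /\ x ∈ t.
Proof.
intros Mx; destruct (singleton_set x Mx) as (s & Ms & Hs).
destruct (hierarchy_exists s Ms) as (t & Mt & Ht).
exists t; repeat apply conj; [exact Mt | exact (hierarchy_transitive s t Ht) |].
apply (hierarchy_subset s Ms t Ht); apply Hs; reflexivity.
Qed.

Lemma rank_exists x : M x -> exists r, M r /\ rank_value x r.
Proof.
apply recursion_exists; trivial.
- exact definable_mem01.
- definability.
- intros; apply mem_wf.
- intros y My; exists y; split; trivial; tauto.
- intros v Mv; exact (adjoin_exists M M_trans M_ZF v v Mv Mv).
Qed.

(** An element [w] of [x] has a rank [s] in [r] and, by induction, is a subset of the value at [s];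
    so it enters the hierarchy by the index [r]. *)
Lemma rank_hierarchy x : M x -> forall r, rank_value x r -> M r ->
  forall u, hierarchy r u -> forall w, w ∈ x -> w ∈ u.
Proof.
induction (mem_wf x) as [x _ IH]; intros Mx r Hr Mr u Hu w Hw.
assert (Mw : M w) by eauto.
destruct (recursion_total_step _ _ x r Hr w Hw) as (s & Hs).
assert (Hsr : s ∈ r).
{ apply (recursion_mem _ _ x r (mem_wf x) Hr); exists w, s; auto. }
assert (Ms : M s) by eauto.
destruct (hierarchy_exists s Ms) as (v & Mv & Hv).
apply (hierarchy_mem r u w Hu); exists s, v; repeat apply conj; trivial.
exact (IH w Hw Mw s Hs Ms v Hv).
Qed.

(** * The lexicographic order on pairs from an ordinal *)

Section Pairing.
Variable S : V.
Hypothesis M_S : M S.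

Lemma definable_lex : definable M (fun e => lex S (e 0) (e 1)).
Proof. pose proof (definable_pair M M_trans M_ZF). unfold lex. definability. Qed.

Lemma definable_eq10 : definable M (fun e => e 1 = e 0).
Proof. definability. Qed.

(** Induction on the first component and, inside it, on the second. An arbitrary [p] is covered too,
    as its predecessors are pairs over [S]. *)
Lemma lex_wf p : Acc (lex S) p.
Proof.
enough (H : forall a, a ∈ S -> forall b, b ∈ S -> forall p, is_pair p a b -> Acc (lex S) p).
{ constructor; intros q (a & Ha & b & Hb & _ & _ & _ & _ & Hq & _); eauto. }
clear p; intros a; induction (mem_wf a) as [a _ IHa]; intros Ha b.
induction (mem_wf b) as [b _ IHb]; intros Hb p Hp.
constructor; intros q (a' & Ha' & b' & Hb' & c & Hc & d & Hd & Hq & Hp' & H).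
destruct (pair_inj M M_trans M_ZF p a b c d); eauto; subst c d.
destruct H as [H|[-> H]]; eauto.
Qed.

Lemma lex_set q : M q -> exists s, M s /\ forall p, p ∈ s <-> lex S p q.
Proof.
intros Mq; pose proof (definable_pair M M_trans M_ZF); pose proof definable_lex.
(* [D] is the product of [S] with itself. *)
destruct (replacement_union M M_trans M_ZF (fun a p => exists b, b ∈ S /\ is_pair p a b) S)
  as (D & MD & HD); trivial.
{ definability. }
{ intros a Ha; assert (Ma : M a) by eauto.
  destruct (replacement M M_trans M_ZF (fun b p => is_pair p a b) S) as (s & Ms & Hs); trivial.
  - definability.
  - intros b p p' _ _ _; apply pair_unique.
  - eauto. }
destruct (separation M M_trans M_ZF (fun p => lex S p q) D) as (s & Ms & Hs); trivial.
{ definability. }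
exists s; split; [exact Ms|]; intros p; rewrite Hs; split; [tauto|].
intros Hp; split; [|exact Hp].
destruct Hp as (a & Ha & b & Hb & _ & _ & _ & _ & Hp & _).
apply HD; eauto; apply (pair_M M M_trans M_ZF p a b); eauto.
Qed.

Lemma lex_code_exists a b : M a -> M b -> exists c, M c /\ lex_code S a b c.
Proof.
intros Ma Mb; destruct (pair_exists M M_trans M_ZF a b Ma Mb) as (p & Mp & Hp).
destruct (recursion_exists M M_trans M_ZF (lex S) (fun v y => y = v)) with (a := p)
  as (c & Mc & Hc); trivial.
- exact definable_lex.
- exact definable_eq10.
- intros; apply lex_wf.
- exact lex_set.
- exact singleton_set.
- exists c; split; trivial; exists p; auto.
Qed.

Lemma lex_code_functional a b c c' : lex_code S a b c -> lex_code S a b c' -> c = c'.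
Proof.
intros (p & Hp & Hc) (p' & Hp' & Hc'); rewrite (pair_unique p' p a b Hp' Hp) in Hc'.
exact (recursion_functional _ _ p (lex_wf p) c c' Hc Hc').
Qed.

Lemma definable_lex_code : definable M (fun e => lex_code S (e 0) (e 1) (e 2)).
Proof.
pose proof (definable_pair M M_trans M_ZF) as HP.
assert (HR : definable M (fun e => recursion (lex S) (fun v y => y = v) (e 0) (e 1))).
{ apply definable_recursion; trivial.
  - exact definable_lex.
  - exact definable_eq10.
  - intros; apply lex_wf.
  - exact lex_set.
  - exact singleton_set. }
apply definable_equiv with (fun e => exists p, M p /\
  (is_pair p (e 0) (e 1) /\ recursion (lex S) (fun v y => y = v) p (e 2)));
  [|definability].
intros e He; split.
- intros (p & _ & Hp); exists p; exact Hp.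
- intros (p & Hp & Hc); exists p; repeat apply conj; trivial.
  apply (pair_M M M_trans M_ZF p (e 0) (e 1)); auto.
Qed.

Hypothesis S_ord : is_ordinal S.

Lemma lex_trans p q r : lex S p q -> lex S q r -> lex S p r.
Proof.
intros (a & Ha & b & Hb & c & Hc & d & Hd & Hp & Hq & H)
  (c' & Hc' & d' & Hd' & a' & Ha' & b' & Hb' & Hq' & Hr & H').
destruct (pair_inj M M_trans M_ZF q c d c' d'); eauto; subst c' d'.
exists a; split; trivial; exists b; split; trivial.
exists a'; split; trivial; exists b'; split; trivial.
split; trivial; split; trivial.
assert (Oa : is_ordinal a') by exact (ordinal_mem _ _ S_ord Ha').
assert (Ob : is_ordinal b') by exact (ordinal_mem _ _ S_ord Hb').
destruct H as [H|[-> H]], H' as [H'|[E H']]; subst; auto.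
- left; exact (proj1 Oa c a H' H).
- right; split; trivial; exact (proj1 Ob d b H' H).
Qed.

(** The collapse of a transitive relation has transitive sets as values; by induction their elements
    are ordinals. *)
Lemma lex_code_ordinal a b c : lex_code S a b c -> is_ordinal c.
Proof.
intros (p & _ & Hc); revert c Hc; induction (lex_wf p) as [p _ IH]; intros c Hc.
assert (Hmem := recursion_mem _ _ p c (lex_wf p) Hc).
apply ordinal_intro.
- intros y z Hy Hz; apply Hmem in Hy; destruct Hy as (q & v & Hq & Hv & ->).
  apply (recursion_mem _ _ q v (lex_wf q) Hv) in Hz.
  destruct Hz as (r & w & Hr & Hw & ->).
  apply Hmem; exists r, w; repeat apply conj; trivial; exact (lex_trans r q p Hr Hq).
- intros y Hy; apply Hmem in Hy; destruct Hy as (q & v & Hq & Hv & ->).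
  exact (IH q Hq v Hv).
Qed.

(** Two distinct pairs are comparable, and the code of the smaller is an element of the code of the
    larger, so the codes differ. *)
Lemma lex_code_inj a b a' b' c : a ∈ S -> b ∈ S -> a' ∈ S -> b' ∈ S ->
  lex_code S a b c -> lex_code S a' b' c -> a = a' /\ b = b'.
Proof.
intros Ha Hb Ha' Hb' (p & Hp & Hc) (q & Hq & Hc').
assert (Hlt : forall p q, recursion (lex S) (fun v y => y = v) p c ->
  recursion (lex S) (fun v y => y = v) q c -> ~ lex S p q).
{ clear - M_trans M_ZF M_S; intros p q Hp Hq H.
  apply (mem_irrefl c), (recursion_mem _ _ q c (lex_wf q) Hq); exists p, c; auto. }
assert (H1 := Hlt p q Hc Hc'); assert (H2 := Hlt q p Hc' Hc).
destruct (proj2 S_ord a a' Ha Ha') as [H|[->|H]].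
- destruct H1; exists a; split; trivial; exists b; split; trivial.
  exists a'; split; trivial; exists b'; auto 6.
- split; trivial; destruct (proj2 S_ord b b' Hb Hb') as [H|[->|H]]; trivial.
  + destruct H1; exists a'; split; trivial; exists b; split; trivial.
    exists a'; split; trivial; exists b'; auto 7.
  + destruct H2; exists a'; split; trivial; exists b'; split; trivial.
    exists a'; split; trivial; exists b; auto 7.
- destruct H2; exists a'; split; trivial; exists b'; split; trivial.
  exists a; split; trivial; exists b; auto 6.
Qed.

End Pairing.
End Constructions.

(** * Coding of relations *)

Section Sums.
Context {V : set_universe}.

(** With injective [T0] and [T1] of disjoint ranges, [w] is a disjoint union of [x] and [y]. *)
Definition sum_code (T0 T1 : V -> V -> Prop) (x y w : V) : Prop :=
  forall v, v ∈ w <-> (exists z, z ∈ x /\ T0 z v) \/ (exists z, z ∈ y /\ T1 z v).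

Record tagging (M : class V) (T : V -> V -> Prop) : Prop := {
  tagging_definable : definable M (fun e => T (e 0) (e 1));
  tagging_total : forall z, M z -> exists w, M w /\ T z w;
  tagging_functional : forall z w w', T z w -> T z w' -> w = w'
}.

(** Definability is asked in both models because a set of codes is formed in [M] and decoded in [N].
    Codes have to exist in [M]; in [N] they are read off from the transferred set. *)
Record pair_coding (M N : class V) (A : V) (C : V -> V -> V -> Prop) : Prop := {
  coding_definable_M : definable M (fun e => C (e 0) (e 1) (e 2));
  coding_definable_N : definable N (fun e => C (e 0) (e 1) (e 2));
  coding_total : forall x y, x ∈ A -> y ∈ A -> exists w, M w /\ C x y w;
  coding_functional : forall x y w w', C x y w -> C x y w' -> w = w';
  coding_inj : forall x y x' y' w, x ∈ A -> y ∈ A -> x' ∈ A -> y' ∈ A ->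
    C x y w -> C x' y' w -> x = x' /\ y = y'
}.

Lemma tagging_M M T z w : tagging M T -> M z -> T z w -> M w.
Proof.
intros [_ Ht Hf] Mz Hw; destruct (Ht z Mz) as (w' & Mw' & Hw').
now rewrite (Hf z w w').
Qed.

Lemma definable_sum_code (M : class V) T0 T1 :
  transitive_class M -> tagging M T0 -> tagging M T1 ->
  definable M (fun e => sum_code T0 T1 (e 0) (e 1) (e 2)).
Proof.
intros HT H0 H1.
assert (D0 := tagging_definable _ _ H0); assert (D1 := tagging_definable _ _ H1).
apply definable_equiv with (fun e => forall v, M v ->
  (v ∈ e 2 <-> (exists z, z ∈ e 0 /\ T0 z v) \/ (exists z, z ∈ e 1 /\ T1 z v)));
  [|definability].
intros e He; split; intros H v; [|auto]; split; intros Hv.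
- apply H; eauto.
- apply H; [|exact Hv].
  destruct Hv as [(z & Hz & Hv)|(z & Hz & Hv)];
    [apply (tagging_M M T0 z) | apply (tagging_M M T1 z)]; eauto.
Qed.

Lemma image_exists (M : class V) T x : transitive_class M -> models_ZF M ->
  tagging M T -> M x -> exists b, M b /\ forall w, w ∈ b <-> exists z, z ∈ x /\ T z w.
Proof.
intros HT HZ Ht Mx.
destruct (replacement M HT HZ T x) as (b & Mb & Hb); trivial.
- exact (tagging_definable _ _ Ht).
- intros z w w' _ _ _; apply (tagging_functional _ _ Ht).
- exists b; split; [exact Mb|]; intros w; split; intros Hw.
  + apply Hb; eauto.
  + apply Hb; [|exact Hw]; destruct Hw as (z & Hz & Hw); apply (tagging_M M T z); eauto.
Qed.

(** The tag of an element of [x] lies in [w]; since the two kinds of tags are disjoint on [D], it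
    comes from [x'], and by injectivity from the same element. The same holds for [y], and the
    situation is symmetric. *)
Lemma sum_pair_coding (M N : class V) A T0 T1 (D : V -> Prop) :
  transitive_class M -> models_ZF M -> transitive_class N -> M A ->
  tagging M T0 -> tagging M T1 -> tagging N T0 -> tagging N T1 ->
  (forall x z, x ∈ A -> z ∈ x -> D z) ->
  (forall z z' w, D z -> D z' -> T0 z w -> T0 z' w -> z = z') ->
  (forall z z' w, D z -> D z' -> T1 z w -> T1 z' w -> z = z') ->
  (forall z z' w, D z -> D z' -> T0 z w -> ~ T1 z' w) ->
  pair_coding M N A (sum_code T0 T1).
Proof.
intros HT HZ HT' MA HM0 HM1 HN0 HN1 HD I0 I1 I01; split.
- now apply definable_sum_code.
- now apply definable_sum_code.
- intros x y Hx Hy.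
  destruct (image_exists M T0 x) as (a & Ma & Ha); eauto.
  destruct (image_exists M T1 y) as (b & Mb & Hb); eauto.
  destruct (binary_union_exists M HT HZ a b Ma Mb) as (w & Mw & Hw).
  exists w; split; [exact Mw|]; intros v; rewrite Hw, Ha, Hb; tauto.
- intros x y w w' H H'; apply mem_ext; intros v; rewrite (H v), (H' v); tauto.
- assert (Hsub : forall x y x' y' w, x ∈ A -> y ∈ A -> x' ∈ A -> y' ∈ A ->
    sum_code T0 T1 x y w -> sum_code T0 T1 x' y' w ->
    (forall z, z ∈ x -> z ∈ x') /\ (forall z, z ∈ y -> z ∈ y')).
  { intros x y x' y' w Hx Hy Hx' Hy' H H'; split; intros z Hz.
    - destruct (tagging_total _ _ HM0 z) as (v & _ & Hv); [eauto|].
      assert (Hvw : v ∈ w) by (apply H; eauto).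
      apply H' in Hvw; destruct Hvw as [(z' & Hz' & Hv')|(z' & Hz' & Hv')].
      + rewrite (I0 z z' v); eauto.
      + destruct (I01 z z' v); eauto.
    - destruct (tagging_total _ _ HM1 z) as (v & _ & Hv); [eauto|].
      assert (Hvw : v ∈ w) by (apply H; eauto).
      apply H' in Hvw; destruct Hvw as [(z' & Hz' & Hv')|(z' & Hz' & Hv')].
      + destruct (I01 z' z v); eauto.
      + rewrite (I1 z z' v); eauto. }
  intros x y x' y' w Hx Hy Hx' Hy' H H'.
  destruct (Hsub x y x' y' w) as [H1 H2]; trivial.
  destruct (Hsub x' y' x y w) as [H3 H4]; trivial.
  split; apply mem_ext; intros z; split; auto.
Qed.

Definition adjoins (k z w : V) : Prop := forall x, x ∈ w <-> x ∈ z \/ x = k.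

Lemma tagging_eq (M : class V) : tagging M (fun z w => z = w).
Proof. split; [definability | eauto | congruence]. Qed.

Lemma tagging_adjoins (M : class V) k :
  transitive_class M -> models_ZF M -> M k -> tagging M (adjoins k).
Proof.
intros HT HZ Mk; split.
- apply definable_equiv with
    (fun e => forall x, M x -> (x ∈ e 1 <-> x ∈ e 0 \/ x = k)); [|definability].
  intros e He; split; intros H x; [|auto].
  split; intros Hx; apply H; trivial; [eauto|].
  destruct Hx as [Hx| ->]; eauto.
- intros z Mz; exact (adjoin_exists M HT HZ z k Mz Mk).
- intros z w w' H H'; apply mem_ext; intros x; rewrite (H x), (H' x); tauto.
Qed.

Lemma tagging_lex_code_diag (M : class V) S :
  transitive_class M -> models_ZF M -> M S -> tagging M (fun z w => lex_code S z z w).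
Proof.
intros HT HZ MS; pose proof (definable_lex_code M HT HZ S MS); split.
- definability.
- intros z Mz; now apply lex_code_exists.
- intros z w w'; now apply (lex_code_functional M).
Qed.

Lemma tagging_lex_code (M : class V) S k :
  transitive_class M -> models_ZF M -> M S -> M k ->
  tagging M (fun z w => lex_code S z k w).
Proof.
intros HT HZ MS Mk; pose proof (definable_lex_code M HT HZ S MS); split.
- definability.
- intros z Mz; now apply lex_code_exists.
- intros z w w'; now apply (lex_code_functional M).
Qed.

Lemma level_step_inv (a x : V) : ~ is_empty a -> level a x ->
  forall y, y ∈ x -> exists b, b ∈ a /\ level b y.
Proof. intros Ha Hx; destruct Hx; tauto. Qed.

Lemma level_adjoin_ordinal (a z k w : V) : is_ordinal k -> adjoins k z w ->
  level a z -> level a w.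
Proof.
intros Hk Hw Hz; destruct Hz as [a z Ha Hz|a z Ha Hz].
- apply level_empty; trivial; intros y Hy; apply Hw in Hy; destruct Hy as [Hy| ->]; auto.
- apply level_step; trivial; intros y Hy; apply Hw in Hy; destruct Hy as [Hy| ->]; auto.
  destruct (nonempty_mem a Ha) as (b & Hb); exists b; split; trivial.
  now apply level_ordinal.
Qed.

(** * Two models with the same [alpha]-sets: coding pairs *)

Section TwoModels.
Variables (M N : class V) (alpha : V).
Hypothesis M_trans : transitive_class M.
Hypothesis M_ZF : models_ZF M.
Hypothesis N_trans : transitive_class N.
Hypothesis N_ZF : models_ZF N.
Hypothesis alpha_ord : is_ordinal alpha.
Hypothesis same_levels : forall x, level alpha x -> (M x <-> N x).

(** Ordinals have every level, so they are among the common [alpha]-sets. *)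
Lemma same_ordinals o : is_ordinal o -> (M o <-> N o).
Proof. intros Ho; now apply same_levels, level_ordinal. Qed.

(** Sets of codes have level [alpha], so those that belong to one model belong to the other. *)
Definition code_level (A : V) (C : V -> V -> V -> Prop) : Prop :=
  forall E, (forall w, w ∈ E -> exists x y, x ∈ A /\ y ∈ A /\ C x y w) -> level alpha E.

Lemma pair_coding_zero A : is_empty alpha -> M A -> level alpha A ->
  exists C, pair_coding M N A C /\ code_level A C.
Proof.
intros He MA HA.
destruct (ordinal_bound M M_trans M_ZF A MA) as (S & MS & OS & HS).
assert (NS : N S) by now apply same_ordinals.
assert (HAS : forall x, x ∈ A -> x ∈ S).
{ intros x Hx; destruct HA as [a A _ HA|a A Hne _]; [auto | contradiction]. }
exists (lex_code S); split; [split|].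
- now apply definable_lex_code.
- now apply definable_lex_code.
- intros x y Hx Hy; apply lex_code_exists; eauto.
- intros x y w w'; now apply (lex_code_functional M).
- intros x y x' y' w Hx Hy Hx' Hy'; apply (lex_code_inj M); auto.
- intros E HE; apply level_empty; trivial.
  intros w Hw; destruct (HE w Hw) as (x & y & Hx & Hy & Hc).
  exact (lex_code_ordinal M M_trans M_ZF S MS OS x y w Hc).
Qed.

(** The hypotheses on [alpha] say that it is 1. With [k] above all ordinals in members of [A] and
    [S = k + 1], the element [z] is tagged by the code of [(z, z)] on the left and of [(z, k)] on
    the right; these differ because [z] is never [k]. *)
Lemma pair_coding_one A : ~ is_empty alpha -> (forall b, b ∈ alpha -> is_empty b) ->
  M A -> level alpha A -> exists C, pair_coding M N A C /\ code_level A C.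
Proof.
intros Hne Hall MA HA.
destruct (union_exists M M_trans M_ZF A MA) as (U & MU & HU).
destruct (ordinal_bound M M_trans M_ZF U MU) as (k & Mk & Ok & Hk).
destruct (adjoin_exists M M_trans M_ZF k k Mk Mk) as (S & MS & HS).
assert (OS : is_ordinal S).
{ apply ordinal_intro.
  - intros y z Hy Hz; apply HS; left; apply HS in Hy.
    destruct Hy as [Hy| ->]; trivial; exact (proj1 Ok y z Hy Hz).
  - intros y Hy; apply HS in Hy; destruct Hy as [Hy| ->]; trivial.
    exact (ordinal_mem _ _ Ok Hy). }
assert (NS : N S) by now apply same_ordinals.
assert (Nk : N k) by now apply same_ordinals.
assert (HkS : k ∈ S) by (apply HS; auto).
assert (Hsub : forall z, z ∈ k -> z ∈ S) by (intros z Hz; apply HS; auto).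
exists (sum_code (fun z w => lex_code S z z w) (fun z w => lex_code S z k w)); split.
- apply sum_pair_coding with (D := fun z => z ∈ k); trivial.
  + now apply tagging_lex_code_diag.
  + now apply tagging_lex_code.
  + now apply tagging_lex_code_diag.
  + now apply tagging_lex_code.
  + intros x z Hx Hz; apply Hk; [apply HU; eauto|].
    destruct (level_step_inv _ _ Hne HA x Hx) as (b & Hb & Hl).
    destruct Hl as [b x _ Hl|b x Hb' _]; [auto | destruct Hb'; auto].
  + intros z z' w Hz Hz' H H'; apply (lex_code_inj M M_trans M_ZF S MS OS z z z' z' w); auto.
  + intros z z' w Hz Hz' H H'; apply (lex_code_inj M M_trans M_ZF S MS OS z k z' k w); auto.
  + intros z z' w Hz Hz' H H'.
    destruct (lex_code_inj M M_trans M_ZF S MS OS z z z' k w) as [_ E]; auto.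
    subst; exact (mem_irrefl k Hz).
- intros E HE; destruct (nonempty_mem alpha Hne) as (b & Hb).
  apply level_step; trivial; intros w Hw; exists b; split; trivial.
  apply level_empty; [auto|]; intros v Hv.
  destruct (HE w Hw) as (x & y & _ & _ & Hc); apply Hc in Hv.
  destruct Hv as [(z & _ & Hv)|(z & _ & Hv)]; revert Hv;
    now apply lex_code_ordinal with (M := M).
Qed.

Lemma pair_coding_ge2 A b0 : b0 ∈ alpha -> ~ is_empty b0 ->
  M A -> level alpha A -> exists C, pair_coding M N A C /\ code_level A C.
Proof.
intros Hb0 Hb0ne MA HA.
assert (Hne : ~ is_empty alpha) by (intros H; exact (H b0 Hb0)).
destruct (union_exists M M_trans M_ZF A MA) as (U & MU & HU).
destruct (union_exists M M_trans M_ZF U MU) as (U' & MU' & HU').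
(* This [k] belongs to no element [z] of a member of [A]: otherwise [k] would be in [U'], hence
   below itself. So adjoining [k] is injective, and its results differ from all untagged
   elements. *)
destruct (ordinal_bound M M_trans M_ZF U' MU') as (k & Mk & Ok & Hk).
assert (Nk : N k) by now apply same_ordinals.
exists (sum_code (fun z w => z = w) (adjoins k)); split.
- apply sum_pair_coding with (D := fun z => ~ k ∈ z); trivial.
  + apply tagging_eq.
  + now apply tagging_adjoins.
  + apply tagging_eq.
  + now apply tagging_adjoins.
  + intros x z Hx Hz Hkz; apply (mem_irrefl k), Hk; trivial.
    apply HU'; exists z; split; trivial; apply HU; eauto.
  + congruence.
  + intros z z' w Hz Hz' H H'; apply mem_ext; intros y; split; intros Hy.
    * assert (Hyw : y ∈ w) by (apply H; auto).
      apply H' in Hyw; destruct Hyw; [trivial | subst; contradiction].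
    * assert (Hyw : y ∈ w) by (apply H'; auto).
      apply H in Hyw; destruct Hyw; [trivial | subst; contradiction].
  + intros z z' w Hz Hz' <- H; apply Hz, H; auto.
- intros E HE; apply level_step; trivial; intros w Hw.
  destruct (HE w Hw) as (x & y & Hx & Hy & Hc).
  destruct (level_step_inv _ _ Hne HA x Hx) as (b & Hb & Hlx).
  destruct (level_step_inv _ _ Hne HA y Hy) as (c & Hc' & Hly).
  (* A common level [d'] for [x] and [y] that also includes [b0] and so is nonempty. Elements of [x]
     and [y] then have levels below [d'], which adjoining an ordinal preserves. *)
  destruct (ordinal_sub_max _ _ _ alpha_ord Hb Hc') as (d & Hd & Hbd & Hcd).
  destruct (ordinal_sub_max _ _ _ alpha_ord Hd Hb0) as (d' & Hd' & Hdd & Hb0d).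
  exists d'; split; trivial.
  assert (Hd'ne : ~ is_empty d').
  { destruct (nonempty_mem b0 Hb0ne) as (a & Ha); intros H; exact (H a (Hb0d a Ha)). }
  assert (Hlx' : level d' x) by (apply (level_mono d' b); auto).
  assert (Hly' : level d' y) by (apply (level_mono d' c); auto).
  apply level_step; trivial; intros v Hv; apply Hc in Hv.
  destruct Hv as [(z & Hz & <-)|(z & Hz & Hv)].
  + exact (level_step_inv _ _ Hd'ne Hlx' z Hz).
  + destruct (level_step_inv _ _ Hd'ne Hly' z Hz) as (a & Ha & Hl).
    exists a; split; trivial; exact (level_adjoin_ordinal a z k v Ok Hv Hl).
Qed.

Lemma pair_coding_exists A : M A -> level alpha A ->
  exists C, pair_coding M N A C /\ code_level A C.
Proof.
intros MA HA.
destruct (classic (is_empty alpha)) as [He|Hne]; [now apply pair_coding_zero|].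
destruct (classic (exists b, b ∈ alpha /\ ~ is_empty b)) as [(b & Hb & Hbne)|H].
- now apply pair_coding_ge2 with b.
- apply pair_coding_one; trivial; intros b Hb; apply NNPP; eauto.
Qed.

(** * Transfer of transitive sets from [M] to [N] *)

Lemma bijection_total (f x y : V) : is_bijection f x y ->
  forall a, a ∈ x -> exists b, b ∈ y /\ pair_in f a b.
Proof. intros (_ & H & _) a Ha; destruct (H a Ha) as (b & Hb & _); exists b; exact Hb. Qed.

Lemma bijection_surj (f x y : V) : is_bijection f x y ->
  forall b, b ∈ y -> exists a, a ∈ x /\ pair_in f a b.
Proof. intros (_ & _ & H) b Hb; destruct (H b Hb) as (a & Ha & _); exists a; exact Ha. Qed.

Lemma bijection_functional (f x y : V) : is_bijection f x y ->
  forall a b b', a ∈ x -> b ∈ y -> b' ∈ y -> pair_in f a b -> pair_in f a b' -> b = b'.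
Proof.
intros (_ & H & _) a b b' Ha Hb Hb' Hp Hp'; destruct (H a Ha) as (c & _ & Hc).
transitivity c; [symmetry|]; apply Hc; split; assumption.
Qed.

Lemma bijection_inj (f x y : V) : is_bijection f x y ->
  forall a a' b, a ∈ x -> a' ∈ x -> b ∈ y -> pair_in f a b -> pair_in f a' b -> a = a'.
Proof.
intros (_ & _ & H) a a' b Ha Ha' Hb Hp Hp'; destruct (H b Hb) as (c & _ & Hc).
transitivity c; [symmetry|]; apply Hc; split; assumption.
Qed.

Lemma transitive_set_transfer t A f : M t -> transitive_set t -> M A -> level alpha A ->
  M f -> is_bijection f t A -> forall z, z ∈ t -> N z.
Proof.
intros Mt Ht MA HA Mf Hf.
destruct (pair_coding_exists A MA HA) as (C & HC & HCl).
assert (CM := coding_definable_M _ _ _ _ HC); assert (CN := coding_definable_N _ _ _ _ HC).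
pose proof (definable_pair_in M M_trans M_ZF) as HPI.
(* [E] will be the set of codes of the pairs [(f y, f z)] with [y ∈ z] in [t]. *)
set (P := fun z w => exists y, y ∈ z /\ exists X, X ∈ A /\ exists Y, Y ∈ A /\
  (pair_in f y X /\ pair_in f z Y /\ C X Y w)).
destruct (replacement_union M M_trans M_ZF P t) as (E & ME & HE); trivial.
{ unfold P; definability. }
{ intros z Hz; assert (Mz : M z) by eauto.
  destruct (replacement M M_trans M_ZF (fun y w => exists X, X ∈ A /\ exists Y, Y ∈ A /\
    (pair_in f y X /\ pair_in f z Y /\ C X Y w)) z) as (s & Ms & Hs); trivial.
  - definability.
  - intros y w w' Hy _ _ (X & HX & Y & HY & H1 & H2 & H3)
      (X' & HX' & Y' & HY' & H1' & H2' & H3').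
    assert (Hyt : y ∈ t) by exact (Ht z y Hz Hy).
    rewrite (bijection_functional f t A Hf y X' X) in H3'; trivial.
    rewrite (bijection_functional f t A Hf z Y' Y) in H3'; trivial.
    exact (coding_functional _ _ _ _ HC X Y w w' H3 H3').
  - exists s; split; trivial. }
assert (HEl : level alpha E).
{ apply HCl; intros w Hw; apply HE in Hw; [|eauto].
  destruct Hw as (z & _ & y & _ & X & HX & Y & HY & _ & _ & Hc); eauto. }
assert (NE : N E) by now apply same_levels.
assert (NA : N A) by now apply same_levels.
set (R := fun X Y => X ∈ A /\ (Y ∈ A /\ exists w, w ∈ E /\ C X Y w)).
(* [f] is an isomorphism from membership on [t] to the decoded relation [R] on [A]. *)
assert (HR : forall X z Y, z ∈ t -> Y ∈ A -> pair_in f z Y ->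
  (R X Y <-> exists y, y ∈ z /\ X ∈ A /\ pair_in f y X)).
{ intros X z Y Hz HY HzY; split.
  - intros (HX & _ & w & Hw & Hc); apply HE in Hw; [|eauto].
    destruct Hw as (z' & Hz' & y & Hy & X' & HX' & Y' & HY' & H1 & H2 & H3).
    destruct (coding_inj _ _ _ _ HC X Y X' Y' w); trivial; subst X' Y'.
    rewrite (bijection_inj f t A Hf z' z Y) in Hy; trivial; eauto.
  - intros (y & Hy & HX & HyX); split; trivial; split; trivial.
    destruct (coding_total _ _ _ _ HC X Y HX HY) as (w & Mw & Hw).
    exists w; split; trivial; apply HE; trivial; exists z; split; trivial.
    exists y; split; trivial; exists X; split; trivial; exists Y; auto. }
assert (RN : definable N (fun e => R (e 0) (e 1))) by (unfold R; definability).
(* Accessibility is a statement about the universe, so it may be proved with [f], although [f] is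
   not yet known to be in [N]. *)
assert (Hwf : forall Y, Acc R Y).
{ assert (Hwf : forall z, z ∈ t -> forall Y, Y ∈ A -> pair_in f z Y -> Acc R Y).
  { intros z; induction (mem_wf z) as [z _ IH]; intros Hz Y HY HzY.
    constructor; intros X HX; apply (HR X z Y Hz HY HzY) in HX.
    destruct HX as (y & Hy & HX & HyX); apply (IH y Hy); eauto. }
  intros Y; constructor; intros X (HX & _).
  destruct (bijection_surj f t A Hf X HX) as (z & Hz & HzX); eauto. }
(* The collapse of [R] inverts [f]. Transitivity of [t] ensures that each element of [z] has an
   image under [f]. *)
assert (Hcollapse : forall z, z ∈ t -> forall Y, Y ∈ A -> pair_in f z Y ->
  forall u, recursion R (fun v y => y = v) Y u -> u = z).
{ intros z; induction (mem_wf z) as [z _ IH]; intros Hz Y HY HzY u Hu.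
  assert (Hmem := recursion_mem _ _ Y u (Hwf Y) Hu).
  apply mem_ext; intros y; rewrite Hmem; split.
  - intros (X & v & HX & Hv & ->); apply (HR X z Y Hz HY HzY) in HX.
    destruct HX as (y & Hy & HX & HyX).
    rewrite (IH y Hy (Ht z y Hz Hy) X HX HyX v Hv); exact Hy.
  - intros Hy; assert (Hyt : y ∈ t) by exact (Ht z y Hz Hy).
    destruct (bijection_total f t A Hf y Hyt) as (X & HX & HyX).
    assert (HXY : R X Y) by (apply (HR X z Y Hz HY HzY); eauto).
    destruct (recursion_total_step _ _ Y u Hu X HXY) as (v & Hv).
    exists X, v; split; trivial; split; trivial.
    symmetry; exact (IH y Hy Hyt X HX HyX v Hv). }
intros z Hz; destruct (bijection_total f t A Hf z Hz) as (Y & HY & HzY).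
destruct (recursion_exists N N_trans N_ZF R (fun v y => y = v)) with (a := Y)
  as (u & Nu & Hu); eauto.
- definability.
- intros X NX; destruct (separation N N_trans N_ZF (fun d => R d X) A) as (s & Ns & Hs);
    trivial; [definability|].
  exists s; split; trivial; intros d; rewrite Hs; split; [tauto|].
  intros Hd; split; trivial; apply Hd.
- intros v Nv; now apply (singleton_set N N_trans N_ZF).
- now rewrite <- (Hcollapse z Hz Y HY HzY u Hu).
Qed.

(** * Both inclusions between the models *)

Hypothesis KWP : models_KWP alpha M.

Lemma KWP_level x : M x ->
  exists A f, M A /\ level alpha A /\ M f /\ is_bijection f x A.
Proof.
intros Mx; destruct (KWP x Mx) as (A & MA & HA & f & Mf & Hf).
exists A, f; split; trivial; split; [|now split].
exact (alpha_set_level M alpha alpha_ord A HA).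
Qed.

Lemma M_sub_N x : M x -> N x.
Proof.
intros Mx; destruct (transitive_set_containing M M_trans M_ZF x Mx) as (t & Mt & Ht & Hx).
destruct (KWP_level t Mt) as (A & f & MA & HA & Mf & Hf).
exact (transitive_set_transfer t A f Mt Ht MA HA Mf Hf x Hx).
Qed.

Lemma N_sub_M x : N x -> M x.
Proof.
induction (mem_wf x) as [x _ IH]; intros Nx.
assert (HxM : forall z, z ∈ x -> M z) by eauto.
destruct (rank_exists N N_trans N_ZF x Nx) as (r & Nr & Hr).
assert (Mr : M r) by (apply same_ordinals; trivial; exact (rank_ordinal x r Hr)).
destruct (hierarchy_exists M M_trans M_ZF r Mr) as (y & My & Hy).
(* The elements of [x] are in [M] by induction and have ranks below [r], so they occur in the
   hierarchy of [M] at [r]. *)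
assert (Hxy : forall z, z ∈ x -> z ∈ y).
{ intros z Hz; assert (Mz := HxM z Hz).
  destruct (recursion_total_step _ _ x r Hr z Hz) as (s & Hs).
  assert (Hsr : s ∈ r) by (apply (recursion_mem _ _ x r (mem_wf x) Hr); exists z, s; auto).
  assert (Ms : M s) by eauto.
  destruct (hierarchy_exists M M_trans M_ZF s Ms) as (v & Mv & Hv).
  apply (hierarchy_mem M r y z Hy); exists s, v; split; trivial; split; trivial.
  split; trivial; exact (rank_hierarchy M M_trans M_ZF z Mz s Hs Ms v Hv). }
destruct (KWP_level y My) as (A & f & MA & HA & Mf & Hf).
assert (NA : N A) by now apply M_sub_N.
assert (Nf : N f) by now apply M_sub_N.
pose proof (definable_pair_in N N_trans N_ZF) as HPN.
pose proof (definable_pair_in M M_trans M_ZF) as HPM.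
(* [B] is the image of [x] under [f], formed in [N]. As a subset of [A] it has level [alpha] and is
   thus in [M], where its preimage [x'] is formed. *)
destruct (separation N N_trans N_ZF (fun b => exists z, z ∈ x /\ pair_in f z b) A)
  as (B & NB & HB); trivial.
{ definability. }
assert (MB : M B).
{ apply same_levels; trivial; apply (level_subset alpha A); trivial.
  intros b Hb; now apply HB. }
destruct (separation M M_trans M_ZF (fun z => exists b, b ∈ B /\ pair_in f z b) y)
  as (x' & Mx' & Hx'); trivial.
{ definability. }
replace x with x'; trivial.
apply mem_ext; intros z; rewrite Hx'; split.
- intros (Hz & b & Hb & Hzb); apply HB in Hb; destruct Hb as (Hb & z' & Hz' & Hzb').
  rewrite (bijection_inj f y A Hf z z' b); auto.
- intros Hz; split; [auto|].
  destruct (bijection_total f y A Hf z (Hxy z Hz)) as (b & Hb & Hzb).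
  exists b; split; trivial; apply HB; eauto.
Qed.

End TwoModels.
End Sums.

Theorem mainTheorem2 (V : set_universe) (alpha : V) (M N : class V)
    (Halpha : is_ordinal alpha)
    (HMtrans : transitive_class M) (HMZF : models_ZF M)
    (HNtrans : transitive_class N) (HNZF : models_ZF N)
    (Hsame : same_alpha_sets alpha M N)
    (HKWP : models_KWP alpha M) :
  forall x : V, M x <-> N x.
Proof.
(* For sets of either model, having level [alpha] implies being an [alpha]-set in that model, so
   [Hsame] applies. *)
assert (Hlev : forall x, level alpha x -> (M x <-> N x)).
{ intros x Hx; split; intros H;
    apply (Hsame x); split; trivial; now apply level_alpha_set. }
intros x; split.
- now apply (M_sub_N M N alpha).
- now apply (N_sub_M M N alpha).
Qed.
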